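(* For $0<\sigma<\pi$ and $\Re(s)>1$, \[ \mathrm{SLs}(s;\sigma)=\zeta_{\mathrm{CB}}(s;\sin(\sigma/2))-\frac{\sigma}{\pi}\,\eta_{\mathrm{CB}}(s;\sin(\sigma/2)). \] In particular, the right-hand side provides an analytic continuation of $\mathrm{SLs}(s;\sigma)$ to all $s\in\mathbb{C}$.
   Context: For $0<\sigma\le\pi$ and $\Re(s)>1$, $\mathrm{SLs}(s;\sigma)=\frac{1}{\Gamma(s-1)}\int_0^\sigma(\theta-\sigma)\left(-2\log\frac{\sin(\theta/2)}{\sin(\sigma/2)}\right)^{s-2}\mathrm{d}\theta$. For $|z|<1$ and $s\in\mathbb{C}$, $\zeta_{\mathrm{CB}}(s;z)=\sum_{m=1}^\infty\frac{(2z)^{2m}}{\binom{2m}{m}m^s}$ and $\eta_{\mathrm{CB}}(s;z)=\sum_{m=0}^\infty\frac{(2z)^{2m+1}}{\binom{2m+1}{m+1/2}(m+1/2)^s}$, where $\binom{2m+1}{m+1/2}=\Gamma(2m+2)/\Gamma(m+3/2)^2$; these series converge for all $s\in\mathbb{C}$. *)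

(* Defs.v *)
From Stdlib Require Import Reals.
From Coquelicot Require Import Coquelicot.

Local Open Scope C_scope.

Definition Cexp (z : C) : C :=
  RtoC (exp (Re z)) * (cos (Im z), sin (Im z)).

(* x^s with the real logarithm of x; meaningful only for 0 < x. *)
Definition Rcpow (x : R) (s : C) : C := Cexp (s * RtoC (ln x)).

(* Improper integral of a complex-valued function of a real variable.  Like the
   library's total operators, CRInt_gen and CSeries return an unspecified value
   in case of divergence. *)
Definition CRInt_gen (f : R -> C) (Fa Fb : (R -> Prop) -> Prop) : C :=
  @RInt_gen C_R_CompleteNormedModule f Fa Fb.

Definition CSeries (a : nat -> C) : C :=
  @iota C_CompleteNormedModule (@is_series C_AbsRing C_NormedModule a).

(* Euler's integral; it defines Gamma on the half-plane Re s > 0, which contains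
   every argument used below. *)
Definition CGamma (s : C) : C :=
  CRInt_gen (fun t : R => Rcpow t (s - 1) * RtoC (exp (- t)))
            (at_right 0) (Rbar_locally p_infty).

(* On 0 < theta < sigma the base of the power is positive.  The integral is
   improper at both ends: the base tends to infinity at 0 and to 0 at sigma. *)
Definition SLs (s : C) (sigma : R) : C :=
  / CGamma (s - 1) *
  CRInt_gen
    (fun theta : R =>
       RtoC (theta - sigma) *
       Rcpow (- 2 * ln (sin (theta / 2) / sin (sigma / 2))) (s - 2))
    (at_right 0) (at_left sigma).

(* The sum over m >= 1, reindexed by m = S k; Binomial.C is the binomial
   coefficient, shadowed here by the type C. *)
Definition zetaCB (s z : C) : C :=
  CSeries (fun k : nat =>
    let m := S k in
    (2 * z) ^ (2 * m) / (RtoC (Binomial.C (2 * m) m) * Rcpow (INR m) s)).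

(* The generalized binomial coefficient (2m+1 choose m+1/2). *)
Definition half_binom (m : nat) : C :=
  CGamma (RtoC (2 * INR m + 2)) / (CGamma (RtoC (INR m + 3 / 2)) ^ 2).

Definition etaCB (s z : C) : C :=
  CSeries (fun m : nat =>
    (2 * z) ^ (2 * m + 1) / (half_binom m * Rcpow (INR m + 1 / 2) s)).

(* For an open set D. *)
Definition analytic_on (D : C -> Prop) (f : C -> C) : Prop :=
  forall z : C, D z -> @ex_derive C_AbsRing C_NormedModule f z.

(* g is an analytic continuation to E of the function f given on D. *)
Definition analytic_continuation
    (D : C -> Prop) (f : C -> C) (E : C -> Prop) (g : C -> C) : Prop :=
  (forall z : C, D z -> E z) /\
  analytic_on E g /\
  (forall z : C, D z -> g z = f z).

(* Main.v *)
(** The substitution u = -2 log(sin(theta/2) / sin(sigma/2)) turns Gamma(s-1) SLs(s; sigma) into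
    minus the Mellin transform of sigma tan t - 2 t tan t, where t = theta/2 and
    sin t = sin(sigma/2) e^(-u/2).  The expansions of 1/cos t and of t/(sin t cos t) in powers of
    sin^2 t make this function a series of exponentials e^(-lambda u), which integrates term by
    term to Gamma(s-1) times a Dirichlet series; one divides by Gamma(s-1), which has no zero.
    The half-integer binomials bring in Gamma(1/2)^2 = pi, obtained from the log-convexity of
    Gamma and Wallis' integrals.  The coefficients decay geometrically, so both Dirichlet series
    are entire in s. *)

Require Import Defs.
From Stdlib Require Import Reals Factorial Lra Lia.
From Coquelicot Require Import Coquelicot.

Local Open Scope R_scope.

(** * Complex exponentials and powers *)

(** [CRInt_gen] and [CSeries] are total operators, so an equation about them carries information
    only once the limit is known to exist; values are therefore read off from convergence statements
    by uniqueness of limits.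

    A Mellin transform at s - 1 sends e^(-lambda u) to Gamma(s-1) lambda^(1-s). The Dirichlet series
    below thus use the exponent 1 - s, and one factor lambda of each binomial term moves out of its
    coefficient.

    The weight u^(s-2) may be singular at 0, so plain uniform convergence does not allow integration
    term by term. Since every lambda is at least 1/2, the tails of the series are small relative to
    e^(-u/2), and uniform convergence relative to an integrable weight suffices.

    [CGamma] is known only through Euler's integral; that it has no zero is deduced from the
    functional equation together with an estimate of that integral.

    The assumption sigma < PI enters as sin^2(sigma/2) < 1, which is the ratio of the geometric
    decay. The 1/pi beside sigma is undone by the pi hidden in the half-integer binomials. *)

Lemma C_eq (x y : C) : Re x = Re y -> Im x = Im y -> x = y.
Proof. destruct x, y; simpl; intros; subst; reflexivity. Qed.

Lemma Im_le_Cmod (z : C) : Rabs (Im z) <= Cmod z.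
Proof. eapply Rle_trans; [ apply Rmax_r | apply Rmax_Cmod ]. Qed.

Lemma Cexp_plus (a b : C) : Cexp (a + b) = (Cexp a * Cexp b)%C.
Proof.
  unfold Cexp, Re, Im. apply C_eq; simpl; rewrite exp_plus, ?cos_plus, ?sin_plus; ring.
Qed.

Lemma Cmod_Cexp (z : C) : Cmod (Cexp z) = exp (Re z).
Proof.
  unfold Cexp. rewrite Cmod_mult, Cmod_R, Rabs_pos_eq by (left; apply exp_pos).
  replace (Cmod (cos (Im z), sin (Im z))) with 1; [ ring | ].
  unfold Cmod; simpl fst; simpl snd.
  replace (_ + _) with (Rsqr (sin (Im z)) + Rsqr (cos (Im z))) by (unfold Rsqr; ring).
  rewrite sin2_cos2, sqrt_1; reflexivity.
Qed.

Lemma Cexp_RtoC (x : R) : Cexp (RtoC x) = RtoC (exp x).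
Proof. unfold Cexp; simpl. rewrite cos_0, sin_0. apply C_eq; simpl; ring. Qed.

Lemma Rcpow_plus (x : R) (s t : C) : Rcpow x (s + t) = (Rcpow x s * Rcpow x t)%C.
Proof. unfold Rcpow. rewrite <- Cexp_plus. f_equal. ring. Qed.

Lemma Rcpow_0 (x : R) : Rcpow x 0 = 1%C.
Proof.
  unfold Rcpow. replace (0 * RtoC (ln x))%C with (RtoC 0) by ring.
  rewrite Cexp_RtoC, exp_0. reflexivity.
Qed.

Lemma Rcpow_RtoC (x p : R) : Rcpow x (RtoC p) = RtoC (exp (p * ln x)).
Proof. unfold Rcpow. rewrite <- RtoC_mult, Cexp_RtoC. reflexivity. Qed.

Lemma Rcpow_1 (x : R) : 0 < x -> Rcpow x 1 = RtoC x.
Proof. intros Hx. rewrite Rcpow_RtoC, Rmult_1_l, exp_ln by exact Hx. reflexivity. Qed.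

Lemma Rcpow_opp (x : R) (s : C) : (Rcpow x s * Rcpow x (- s))%C = 1%C.
Proof. rewrite <- Rcpow_plus. replace (s + - s)%C with (RtoC 0) by ring. apply Rcpow_0. Qed.

Lemma Rcpow_neq_0 (x : R) (s : C) : Rcpow x s <> 0%C.
Proof.
  intros H. generalize (Rcpow_opp x s). rewrite H, Cmult_0_l.
  intros E. apply (f_equal Re) in E. simpl in E. lra.
Qed.

Lemma Rcpow_opp_inv (x : R) (s : C) : Rcpow x (- s) = (/ Rcpow x s)%C.
Proof.
  assert (H := Rcpow_neq_0 x s).
  replace (Rcpow x (- s)) with (/ Rcpow x s * (Rcpow x s * Rcpow x (- s)))%C by (now field).
  rewrite Rcpow_opp. ring.
Qed.

Lemma Rcpow_mult (x y : R) (s : C) :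
  0 < x -> 0 < y -> Rcpow (x * y) s = (Rcpow x s * Rcpow y s)%C.
Proof.
  intros Hx Hy. unfold Rcpow.
  rewrite ln_mult, RtoC_plus, Cmult_plus_distr_l, Cexp_plus by assumption. reflexivity.
Qed.

Lemma Cmod_Rcpow (x : R) (s : C) : Cmod (Rcpow x s) = exp (Re s * ln x).
Proof. unfold Rcpow. rewrite Cmod_Cexp. f_equal. unfold Re; simpl. ring. Qed.

(** * Improper integrals of complex-valued functions *)

Lemma filterlim_C {T : Type} {F : (T -> Prop) -> Prop} {FF : Filter F} (f : T -> C) (l : C) :
  filterlim (fun x => Re (f x)) F (locally (Re l)) ->
  filterlim (fun x => Im (f x)) F (locally (Im l)) ->
  filterlim f F (locally l).
Proof.
  intros H1 H2. apply filterlim_locally. intros eps.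
  apply filterlim_locally with (eps := eps) in H1.
  apply filterlim_locally with (eps := eps) in H2.
  generalize (filter_and _ _ H1 H2). apply filter_imp.
  intros x [A B]. split; assumption.
Qed.

Lemma filterlim_Re {T : Type} {F : (T -> Prop) -> Prop} {FF : Filter F} (f : T -> C) (l : C) :
  filterlim f F (locally l) -> filterlim (fun x => Re (f x)) F (locally (Re l)).
Proof.
  intros H. apply filterlim_locally. intros eps.
  apply filterlim_locally with (eps := eps) in H.
  generalize H. apply filter_imp. intros x [A _]. exact A.
Qed.

Lemma filterlim_Im {T : Type} {F : (T -> Prop) -> Prop} {FF : Filter F} (f : T -> C) (l : C) :
  filterlim f F (locally l) -> filterlim (fun x => Im (f x)) F (locally (Im l)).
Proof.
  intros H. apply filterlim_locally. intros eps.
  apply filterlim_locally with (eps := eps) in H.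
  generalize H. apply filter_imp. intros x [_ A]. exact A.
Qed.

(** Neighbourhoods in C come from the product structure, hence from boxes; equivalence with norm
    balls lets all later estimates be made with [Cmod]. *)
Lemma filterlim_C_eps {T : Type} {F : (T -> Prop) -> Prop} {FF : Filter F} (f : T -> C) (l : C) :
  filterlim f F (locally l) <->
  (forall eps, 0 < eps -> F (fun x => Cmod (f x - l) < eps)).
Proof.
  split.
  - intros H eps Heps.
    apply (H (fun y => Cmod (y - l) < eps)).
    apply (locally_le_locally_norm (V := C_NormedModule)).
    exists (mkposreal eps Heps). intros y Hy. exact Hy.
  - intros H P HP.
    apply (locally_norm_le_locally (V := C_NormedModule)) in HP.
    destruct HP as [eps HP].
    unfold filtermap. generalize (H eps (cond_pos eps)). apply filter_imp.
    intros x Hx. apply HP. exact Hx.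
Qed.

Lemma is_RInt_gen_eps {Fa Fb : (R -> Prop) -> Prop} {FFa : Filter Fa} {FFb : Filter Fb}
    (f : R -> C) (l : C) :
  is_RInt_gen (V := C_R_NormedModule) f Fa Fb l <->
  (forall eps, 0 < eps -> filter_prod Fa Fb (fun ab => exists y : C,
     is_RInt (V := C_R_NormedModule) f (fst ab) (snd ab) y /\ Cmod (y - l) < eps)).
Proof.
  split.
  - intros H eps Heps.
    apply (H (fun y => Cmod (y - l) < eps)).
    apply (locally_le_locally_norm (V := C_NormedModule)).
    exists (mkposreal eps Heps). intros y Hy. exact Hy.
  - intros H P HP.
    apply (locally_norm_le_locally (V := C_NormedModule)) in HP.
    destruct HP as [eps HP].
    unfold filtermapi. generalize (H eps (cond_pos eps)). apply filter_imp.
    intros x [y [Hy Hx]]. exists y. split; [ exact Hy | ]. apply HP. exact Hx.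
Qed.

Lemma is_RInt_Re (f : R -> C) (a b : R) (l : C) :
  is_RInt (V := C_R_NormedModule) f a b l -> is_RInt (fun t => Re (f t)) a b (Re l).
Proof. apply (is_RInt_fct_extend_fst (U := R_NormedModule) (V := R_NormedModule)). Qed.

Lemma is_RInt_Im (f : R -> C) (a b : R) (l : C) :
  is_RInt (V := C_R_NormedModule) f a b l -> is_RInt (fun t => Im (f t)) a b (Im l).
Proof. apply (is_RInt_fct_extend_snd (U := R_NormedModule) (V := R_NormedModule)). Qed.

Lemma is_RInt_C (f : R -> C) (a b : R) (l : C) :
  is_RInt (fun t => Re (f t)) a b (Re l) -> is_RInt (fun t => Im (f t)) a b (Im l) ->
  is_RInt (V := C_R_NormedModule) f a b l.
Proof.
  intros H1 H2. destruct l.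
  apply (is_RInt_fct_extend_pair (U := R_NormedModule) (V := R_NormedModule)); assumption.
Qed.

(** Integrals are taken in C as a real module, where [scal] has real scalars only; a complex factor
    is handled through real and imaginary parts. *)
Lemma is_RInt_Cmult (c : C) (f : R -> C) (a b : R) (l : C) :
  is_RInt (V := C_R_NormedModule) f a b l ->
  is_RInt (V := C_R_NormedModule) (fun t => c * f t)%C a b (c * l)%C.
Proof.
  intros H. assert (H1 := is_RInt_Re _ _ _ _ H). assert (H2 := is_RInt_Im _ _ _ _ H).
  apply is_RInt_C.
  - apply (is_RInt_minus (V := R_NormedModule)
             (fun t => Re c * Re (f t)) (fun t => Im c * Im (f t)));
      apply (is_RInt_scal (V := R_NormedModule)); assumption.
  - apply (is_RInt_plus (V := R_NormedModule)
             (fun t => Re c * Im (f t)) (fun t => Im c * Re (f t)));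
      apply (is_RInt_scal (V := R_NormedModule)); assumption.
Qed.

Lemma is_RInt_gen_Cmult {Fa Fb : (R -> Prop) -> Prop} {FFa : Filter Fa} {FFb : Filter Fb}
    (c : C) (f : R -> C) (l : C) :
  is_RInt_gen (V := C_R_NormedModule) f Fa Fb l ->
  is_RInt_gen (V := C_R_NormedModule) (fun t => c * f t)%C Fa Fb (c * l)%C.
Proof.
  intros H. apply is_RInt_gen_eps. intros eps Heps.
  assert (Hc : 0 < Cmod c + 1) by (generalize (Cmod_ge_0 c); lra).
  assert (H' := proj1 (is_RInt_gen_eps _ _) H _ (Rdiv_lt_0_compat _ _ Heps Hc)).
  revert H'. apply filter_imp. intros ab [y [Hy Hl]].
  exists (c * y)%C. split; [ now apply is_RInt_Cmult | ].
  replace (c * y - c * l)%C with (c * (y - l))%C by ring. rewrite Cmod_mult.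
  apply Rlt_div_r in Hl; [ | exact Hc ].
  generalize (Cmod_ge_0 (y - l)); nra.
Qed.

Lemma is_RInt_gen_Re {Fa Fb : (R -> Prop) -> Prop} {FFa : Filter Fa} {FFb : Filter Fb}
    (f : R -> C) (l : C) :
  is_RInt_gen (V := C_R_NormedModule) f Fa Fb l ->
  is_RInt_gen (fun t => Re (f t)) Fa Fb (Re l).
Proof.
  intros H P HP.
  assert (HP' : locally l (fun z : C_R_NormedModule => P (Re z))).
  { destruct HP as [eps HP]. exists eps. intros y [Hy _]. now apply HP. }
  generalize (H _ HP'). unfold filtermapi. apply filter_imp. intros ab [y [Hy Py]].
  exists (Re y). split; [ now apply is_RInt_Re | exact Py ].
Qed.

Lemma is_RInt_gen_Im {Fa Fb : (R -> Prop) -> Prop} {FFa : Filter Fa} {FFb : Filter Fb}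
    (f : R -> C) (l : C) :
  is_RInt_gen (V := C_R_NormedModule) f Fa Fb l ->
  is_RInt_gen (fun t => Im (f t)) Fa Fb (Im l).
Proof.
  intros H P HP.
  assert (HP' : locally l (fun z : C_R_NormedModule => P (Im z))).
  { destruct HP as [eps HP]. exists eps. intros y [_ Hy]. now apply HP. }
  generalize (H _ HP'). unfold filtermapi. apply filter_imp. intros ab [y [Hy Py]].
  exists (Im y). split; [ now apply is_RInt_Im | exact Py ].
Qed.

Lemma norm_C_R (z : C) : norm (V := C_R_NormedModule) z = Cmod z.
Proof.
  unfold Cmod, norm; simpl; unfold prod_norm, norm; simpl; unfold abs; simpl.
  f_equal. rewrite !Rmult_1_r, <- !Rabs_mult, !Rabs_pos_eq by apply Rle_0_sqr.
  reflexivity.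
Qed.

Lemma Cmod_RInt_le (f : R -> C) (g : R -> R) (a b : R) (lf : C) (lg : R) :
  a <= b -> (forall x, a <= x <= b -> Cmod (f x) <= g x) ->
  is_RInt (V := C_R_NormedModule) f a b lf -> is_RInt g a b lg -> Cmod lf <= lg.
Proof.
  intros Hab Hfg Hf Hg.
  rewrite <- norm_C_R. apply (norm_RInt_le (V := C_R_NormedModule) f g a b lf lg Hab).
  - intros x Hx. rewrite norm_C_R. apply Hfg; exact Hx.
  - exact Hf.
  - exact Hg.
Qed.

Lemma filter_prod_and {Fa Fb : (R -> Prop) -> Prop} {FFa : Filter Fa} {FFb : Filter Fb}
    (P Q : R -> Prop) :
  Fa P -> Fb Q -> filter_prod Fa Fb (fun ab => P (fst ab) /\ Q (snd ab)).
Proof. intros HP HQ. exists P Q; auto. Qed.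

Lemma at_right_0_pos : at_right 0 (fun t => 0 < t).
Proof. exists (mkposreal 1 Rlt_0_1). intros y _ Hy. exact Hy. Qed.

Lemma at_right_0_lt (c : R) : 0 < c -> at_right 0 (fun t => 0 < t < c).
Proof.
  intros Hc. exists (mkposreal c Hc). intros y Hy Hy0.
  unfold ball in Hy; simpl in Hy; unfold AbsRing_ball, abs, minus, plus, opp in Hy; simpl in Hy.
  rewrite Ropp_0, Rplus_0_r in Hy. apply Rabs_def2 in Hy. lra.
Qed.

Lemma p_infty_gt (c : R) : Rbar_locally p_infty (fun t => c < t).
Proof. exists c. auto. Qed.

Lemma at_right_0_p_infty_lt (c d : R) :
  0 < c -> filter_prod (at_right 0) (Rbar_locally p_infty)
    (fun ab => 0 < fst ab < c /\ d < snd ab).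
Proof.
  intros Hc. apply (filter_prod_and (fun t => 0 < t < c) (fun t => d < t)).
  - now apply at_right_0_lt.
  - apply p_infty_gt.
Qed.

Lemma at_right_0_p_infty_pos :
  filter_prod (at_right 0) (Rbar_locally p_infty) (fun ab => 0 < fst ab < snd ab).
Proof.
  generalize (at_right_0_p_infty_lt 1 1 Rlt_0_1). apply filter_imp.
  intros [a b]; simpl; lra.
Qed.

Lemma is_RInt_gen_le_0_p_infty (f g : R -> R) (lf lg : R) :
  is_RInt_gen f (at_right 0) (Rbar_locally p_infty) lf ->
  is_RInt_gen g (at_right 0) (Rbar_locally p_infty) lg ->
  (forall t, 0 < t -> f t <= g t) -> lf <= lg.
Proof.
  intros Hf Hg Hfg.
  apply Rnot_lt_le. intros Hlt.
  assert (He : 0 < (lf - lg) / 2) by lra.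
  assert (Hf' := Hf (ball lf (mkposreal _ He)) (locally_ball _ _)).
  assert (Hg' := Hg (ball lg (mkposreal _ He)) (locally_ball _ _)).
  unfold filtermapi in Hf', Hg'.
  destruct (filter_ex _ (filter_and _ _ at_right_0_p_infty_pos (filter_and _ _ Hf' Hg')))
    as [[a b] [Hab [[y [Hy By]] [z [Hz Bz]]]]].
  simpl in *.
  assert (y <= z).
  { apply (is_RInt_le f g a b); try assumption; [ lra | ].
    intros x Hx. apply Hfg. lra. }
  unfold ball in By, Bz; simpl in By, Bz;
    unfold AbsRing_ball, abs, minus, plus, opp in By, Bz; simpl in By, Bz.
  apply Rabs_def2 in By. apply Rabs_def2 in Bz. lra.
Qed.

(** * Convergence of improper integrals: domination, uniform limits, substitution *)

Lemma ex_RInt_pos (f : R -> C) (a b : R) :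
  (forall t, 0 < t -> continuous (U := C_UniformSpace) f t) -> 0 < a -> 0 < b ->
  ex_RInt (V := C_R_NormedModule) f a b.
Proof.
  intros Hf Ha Hb. apply (ex_RInt_continuous (V := C_R_CompleteNormedModule)).
  intros z [Hz _]. apply Hf. revert Hz. unfold Rmin. destruct (Rle_dec a b); lra.
Qed.

(** A convergent [Phi] is Cauchy along [F]; its increments bound those of [G], so [G] is Cauchy too,
    and C is complete. *)
Lemma ex_filterlim_of_dominated {F : (R -> Prop) -> Prop} {FF : ProperFilter F}
    (G : R -> C) (Phi : R -> R) (l : R) :
  F (fun t => 0 < t) ->
  (forall t t', 0 < t -> 0 < t' -> Cmod (G t' - G t) <= Rabs (Phi t' - Phi t)) ->
  filterlim Phi F (locally l) ->
  exists y : C, filterlim G F (locally (T := C_UniformSpace) y).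
Proof.
  intros Hpos HG HPhi.
  apply (filterlim_locally_cauchy (U := C_R_CompleteNormedModule)). intros eps.
  destruct (proj2 (filterlim_locally_cauchy (U := R_CompleteSpace) (F := F) Phi)
              (ex_intro _ l HPhi) eps) as [P [HP HPP]].
  exists (fun t => P t /\ 0 < t). split; [ now apply filter_and | ].
  intros u v [Pu Hu] [Pv Hv].
  apply (norm_compat1 (V := C_NormedModule)).
  eapply Rle_lt_trans; [ apply (HG u v Hu Hv) | ].
  exact (HPP u v Pu Pv).
Qed.

(* The primitive Phi of the dominating function makes the tails of the integral Cauchy at both
   ends. *)
Lemma ex_RInt_gen_dominated (f : R -> C) (Phi phi : R -> R) (la lb : R) :
  (forall t, 0 < t -> continuous (U := C_UniformSpace) f t) ->
  (forall t, 0 < t -> is_derive Phi t (phi t)) ->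
  (forall t, 0 < t -> continuous phi t) ->
  (forall t, 0 < t -> Cmod (f t) <= phi t) ->
  filterlim Phi (at_right 0) (locally la) ->
  filterlim Phi (Rbar_locally p_infty) (locally lb) ->
  exists l : C, is_RInt_gen (V := C_R_NormedModule) f (at_right 0) (Rbar_locally p_infty) l.
Proof.
  intros Hf HPhi Hphi Hle Ha Hb.
  set (G := fun t => RInt (V := C_R_CompleteNormedModule) f 1 t : C).
  assert (Hint : forall a b, 0 < a -> 0 < b ->
             is_RInt (V := C_R_NormedModule) f a b (G b - G a)%C).
  { intros a b H0a H0b.
    assert (E : @eq C (G b) (G a + RInt (V := C_R_CompleteNormedModule) f a b)%C).
    { unfold G. symmetry.
      apply (RInt_Chasles (V := C_R_CompleteNormedModule)); apply ex_RInt_pos; auto; lra. }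
    assert (E' : @eq C (G b - G a)%C (RInt (V := C_R_CompleteNormedModule) f a b))
      by (rewrite E; ring).
    rewrite E'. apply (RInt_correct (V := C_R_CompleteNormedModule)).
    apply ex_RInt_pos; auto. }
  assert (HG0 : forall t t', 0 < t -> t <= t' -> Cmod (G t' - G t) <= Phi t' - Phi t).
  { intros t t' Ht Htt'.
    apply (Cmod_RInt_le f phi t t'); [ exact Htt' | | apply Hint; lra | ].
    - intros x Hx. apply Hle. lra.
    - apply (is_RInt_derive (V := R_CompleteNormedModule) Phi phi);
        intros x Hx; rewrite Rmin_left in Hx by exact Htt';
        [ apply HPhi | apply Hphi ]; lra. }
  assert (HG : forall t t', 0 < t -> 0 < t' -> Cmod (G t' - G t) <= Rabs (Phi t' - Phi t)).
  { intros t t' Ht Ht'. destruct (Rle_dec t t') as [H|H].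
    - eapply Rle_trans; [ now apply HG0 | apply Rle_abs ].
    - replace (G t' - G t)%C with (- (G t - G t'))%C by ring.
      rewrite Cmod_opp, Rabs_minus_sym.
      eapply Rle_trans; [ apply HG0; lra | apply Rle_abs ]. }
  destruct (ex_filterlim_of_dominated G Phi la at_right_0_pos HG Ha) as [ya Hya].
  destruct (ex_filterlim_of_dominated G Phi lb (p_infty_gt 0) HG Hb) as [yb Hyb].
  exists (yb - ya)%C. apply is_RInt_gen_eps. intros eps Heps.
  assert (He : 0 < eps / 2) by lra.
  assert (Hya' := proj1 (filterlim_C_eps _ _) Hya _ He).
  assert (Hyb' := proj1 (filterlim_C_eps _ _) Hyb _ He).
  exists (fun t => 0 < t /\ Cmod (G t - ya) < eps / 2)
         (fun t => 0 < t /\ Cmod (G t - yb) < eps / 2).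
  - apply filter_and; [ apply at_right_0_pos | exact Hya' ].
  - apply filter_and; [ apply p_infty_gt | exact Hyb' ].
  - intros a b [H0a H1] [H0b H2]. exists (G b - G a)%C. split; [ now apply Hint | ].
    replace (G b - G a - (yb - ya))%C with ((G b - yb) + - (G a - ya))%C by ring.
    eapply Rle_lt_trans; [ apply Cmod_triangle | ]. rewrite Cmod_opp. lra.
Qed.

Lemma is_RInt_gen_of_primitive (f F : R -> C) (la lb : C) :
  (forall a b, 0 < a -> 0 < b -> is_RInt (V := C_R_NormedModule) f a b (F b - F a)%C) ->
  filterlim F (at_right 0) (locally (T := C_UniformSpace) la) ->
  filterlim F (Rbar_locally p_infty) (locally (T := C_UniformSpace) lb) ->
  is_RInt_gen (V := C_R_NormedModule) f (at_right 0) (Rbar_locally p_infty) (lb - la)%C.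
Proof.
  intros Hint Ha Hb. apply is_RInt_gen_eps. intros eps Heps.
  assert (He : 0 < eps / 2) by lra.
  assert (Ha' := proj1 (filterlim_C_eps _ _) Ha _ He).
  assert (Hb' := proj1 (filterlim_C_eps _ _) Hb _ He).
  exists (fun t => 0 < t /\ Cmod (F t - la) < eps / 2)
         (fun t => 0 < t /\ Cmod (F t - lb) < eps / 2).
  - apply filter_and; [ apply at_right_0_pos | exact Ha' ].
  - apply filter_and; [ apply p_infty_gt | exact Hb' ].
  - intros a b [H0a H1] [H0b H2]. exists (F b - F a)%C. split; [ now apply Hint | ].
    replace (F b - F a - (lb - la))%C with ((F b - lb) + - (F a - la))%C by ring.
    eapply Rle_lt_trans; [ apply Cmod_triangle | ]. rewrite Cmod_opp. lra.
Qed.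

(** The integral of [f - fn n] over any interval near the full range is at most [delta n] times a
    bound for the integrals of [g]. The index [n] can therefore be fixed first, and the endpoints
    afterwards. *)
Lemma is_RInt_gen_uniform_limit {Fa Fb : (R -> Prop) -> Prop}
    {FFa : ProperFilter Fa} {FFb : ProperFilter Fb}
    (f : R -> C) (fn : nat -> R -> C) (g : R -> R) (delta : nat -> R)
    (ln : nat -> C) (l : C) (lg : R) :
  (forall n, is_RInt_gen (V := C_R_NormedModule) (fn n) Fa Fb (ln n)) ->
  filterlim ln eventually (locally (T := C_UniformSpace) l) ->
  is_lim_seq delta 0 ->
  is_RInt_gen g Fa Fb lg ->
  filter_prod Fa Fb (fun ab => fst ab <= snd ab /\
    ex_RInt (V := C_R_NormedModule) f (fst ab) (snd ab) /\
    forall n x, fst ab <= x <= snd ab -> Cmod (f x - fn n x) <= delta n * g x) ->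
  is_RInt_gen (V := C_R_NormedModule) f Fa Fb l.
Proof.
  intros Hfn Hln Hd Hg Hf. apply is_RInt_gen_eps. intros eps Heps.
  (* [M] bounds the integral of [g] over every interval close enough to the full range; the [+ 1] is
     the radius of the ball used for [Hg']. *)
  set (M := Rabs lg + 1).
  assert (HM : 0 < M) by (unfold M; generalize (Rabs_pos lg); lra).
  assert (Hd' : eventually (fun n => Rabs (delta n) < eps / 4 / M)).
  { apply is_lim_seq_spec in Hd.
    assert (Hp : 0 < eps / 4 / M) by (apply Rdiv_lt_0_compat; lra).
    generalize (Hd (mkposreal _ Hp)). apply filter_imp. simpl. intros n Hn.
    now rewrite Rminus_0_r in Hn. }
  assert (He4 : 0 < eps / 4) by lra.
  assert (Hln' := proj1 (filterlim_C_eps _ _) Hln _ He4).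
  destruct (filter_ex _ (filter_and _ _ Hd' Hln')) as [n [Hdn Hlnn]].
  assert (Hn := proj1 (is_RInt_gen_eps _ _) (Hfn n) _ He4).
  assert (Hg' := Hg (ball lg (mkposreal 1 Rlt_0_1)) (locally_ball _ _)).
  unfold filtermapi in Hg'.
  generalize (filter_and _ _ Hf (filter_and _ _ Hn Hg')). apply filter_imp.
  intros [a b]; simpl. intros [[Hab [[y Hy] Hle]] [[yn [Hyn Hyn']] [yg [Hyg Byg]]]].
  exists y. split; [ exact Hy | ].
  unfold ball in Byg; simpl in Byg;
    unfold AbsRing_ball, abs, minus, plus, opp in Byg; simpl in Byg.
  assert (Hyg' : Rabs yg <= M).
  { unfold M. replace yg with (lg + (yg + - lg)) by ring.
    eapply Rle_trans; [ apply Rabs_triang | lra ]. }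
  assert (H1 : Cmod (y - yn) <= delta n * yg).
  { apply (Cmod_RInt_le (fun x => f x - fn n x)%C (fun x => delta n * g x) a b);
      [ exact Hab | intros x Hx; apply Hle; exact Hx | | ].
    - apply (is_RInt_minus (V := C_R_NormedModule)); assumption.
    - apply (is_RInt_scal (V := R_NormedModule)); assumption. }
  assert (H2 : delta n * yg <= eps / 4).
  { eapply Rle_trans; [ apply Rle_abs | ]. rewrite Rabs_mult.
    apply Rlt_div_r in Hdn; [ | exact HM ].
    generalize (Rabs_pos (delta n)) (Rabs_pos yg). nra. }
  replace (y - l)%C with ((y - yn) + ((yn - ln n) + (ln n - l)))%C by ring.
  eapply Rle_lt_trans; [ apply Cmod_triangle | ].
  generalize (Cmod_triangle (yn - ln n) (ln n - l)). lra.
Qed.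

(** The change of variables on compact intervals is passed to the limit: [phi] carries the filters
    at the ends to [Ga] and [Gb]. A decreasing [phi] is covered by letting [Ga] be the filter at the
    upper end. *)
Lemma is_RInt_gen_comp {Fa Fb Ga Gb : (R -> Prop) -> Prop}
    {FFa : Filter Fa} {FFb : Filter Fb} {FGa : Filter Ga} {FGb : Filter Gb}
    (h : R -> C) (phi dphi : R -> R) (l : C) :
  is_RInt_gen (V := C_R_NormedModule) h Ga Gb l ->
  filterlim phi Fa Ga -> filterlim phi Fb Gb ->
  filter_prod Fa Fb (fun ab => forall x, Rmin (fst ab) (snd ab) <= x <= Rmax (fst ab) (snd ab) ->
    continuous (U := C_UniformSpace) h (phi x) /\ is_derive phi x (dphi x) /\ continuous dphi x) ->
  is_RInt_gen (V := C_R_NormedModule) (fun x => RtoC (dphi x) * h (phi x))%C Fa Fb l.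
Proof.
  intros Hh Ha Hb Hphi. apply is_RInt_gen_eps. intros eps Heps.
  assert (Hh' := proj1 (is_RInt_gen_eps _ _) Hh _ Heps).
  assert (Hh'' : filter_prod Fa Fb (fun ab => exists y : C,
     is_RInt (V := C_R_NormedModule) h (phi (fst ab)) (phi (snd ab)) y /\ Cmod (y - l) < eps)).
  { destruct Hh' as [P Q HP HQ H].
    exists (fun t => P (phi t)) (fun t => Q (phi t)).
    - now apply Ha.
    - now apply Hb.
    - intros x y Px Qy. apply (H (phi x) (phi y) Px Qy). }
  generalize (filter_and _ _ Hphi Hh''). apply filter_imp.
  intros [a b]; simpl; intros [H [y [Hy Hyl]]].
  exists y. split; [ | exact Hyl ].
  rewrite <- (is_RInt_unique (V := C_R_CompleteNormedModule) _ _ _ _ Hy).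
  apply (is_RInt_ext (V := C_R_NormedModule)
           (fun x => scal (V := C_R_ModuleSpace) (dphi x) (h (phi x)))).
  - intros x _. apply C_eq; simpl; unfold scal; simpl; unfold mult; simpl; ring.
  - apply (is_RInt_comp (V := C_R_CompleteNormedModule)).
    + intros x Hx. apply H. exact Hx.
    + intros x Hx. apply H. exact Hx.
Qed.

Lemma Re_Rcpow (x : R) (s : C) : Re (Rcpow x s) = exp (Re s * ln x) * cos (Im s * ln x).
Proof.
  unfold Rcpow, Cexp, Re, Im; simpl.
  replace (fst s * ln x - snd s * 0) with (fst s * ln x) by ring.
  replace (fst s * 0 + snd s * ln x) with (snd s * ln x) by ring. ring.
Qed.

Lemma Im_Rcpow (x : R) (s : C) : Im (Rcpow x s) = exp (Re s * ln x) * sin (Im s * ln x).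
Proof.
  unfold Rcpow, Cexp, Re, Im; simpl.
  replace (fst s * ln x - snd s * 0) with (fst s * ln x) by ring.
  replace (fst s * 0 + snd s * ln x) with (snd s * ln x) by ring. ring.
Qed.

Lemma continuous_Rcpow (s : C) (t : R) :
  0 < t -> continuous (U := C_UniformSpace) (fun t => Rcpow t s) t.
Proof.
  intros Ht. apply filterlim_C.
  - change (continuous (fun x => Re (Rcpow x s)) t).
    apply (continuous_ext (fun t => exp (Re s * ln t) * cos (Im s * ln t))).
    { intros x. symmetry. apply Re_Rcpow. }
    apply (ex_derive_continuous (V := R_NormedModule)). auto_derive. auto.
  - change (continuous (fun x => Im (Rcpow x s)) t).
    apply (continuous_ext (fun t => exp (Re s * ln t) * sin (Im s * ln t))).
    { intros x. symmetry. apply Im_Rcpow. }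
    apply (ex_derive_continuous (V := R_NormedModule)). auto_derive. auto.
Qed.

Lemma continuous_Cmult (f g : R -> C) (t : R) :
  continuous (U := C_UniformSpace) f t -> continuous (U := C_UniformSpace) g t ->
  continuous (U := C_UniformSpace) (fun x => f x * g x)%C t.
Proof.
  intros Hf Hg.
  assert (A := filterlim_Re _ _ Hf). assert (B := filterlim_Im _ _ Hf).
  assert (A' := filterlim_Re _ _ Hg). assert (B' := filterlim_Im _ _ Hg).
  apply filterlim_C.
  - apply (continuous_minus (V := R_NormedModule)
             (fun x => Re (f x) * Re (g x)) (fun x => Im (f x) * Im (g x)));
      apply (continuous_mult (K := R_AbsRing)); assumption.
  - apply (continuous_plus (V := R_NormedModule)
             (fun x => Re (f x) * Im (g x)) (fun x => Im (f x) * Re (g x)));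
      apply (continuous_mult (K := R_AbsRing)); assumption.
Qed.

Lemma continuous_RtoC (f : R -> R) (t : R) :
  continuous f t -> continuous (U := C_UniformSpace) (fun x => RtoC (f x)) t.
Proof.
  intros Hf. apply filterlim_C; simpl;
    [ exact Hf | apply (continuous_const (U := R_UniformSpace) (V := R_UniformSpace)) ].
Qed.

(** * The Gamma function *)

(** This is [1 + x <= exp x] at [x = ln (delta * y)]. The slope [delta] is free, so any power of t
    is dominated by an exponential of arbitrarily small rate. *)
Lemma ln_le_linear (delta y : R) : 0 < delta -> 0 < y -> ln y <= delta * y - ln delta.
Proof.
  intros Hd Hy.
  assert (H := exp_ineq1_le (ln (delta * y))).
  rewrite exp_ln in H by nra. rewrite ln_mult in H by assumption. lra.
Qed.

Lemma exp_le (x y : R) : x <= y -> exp x <= exp y.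
Proof. intros [H|H]; [ left; now apply exp_increasing | subst; lra ]. Qed.

Lemma rpow_le_exp (p eps : R) : 0 <= p -> 0 < eps ->
  exists K, 0 < K /\ forall t, 0 < t -> exp (p * ln t) <= K * exp (eps * t).
Proof.
  intros Hp He.
  (* Any slope [delta] with [p * delta <= eps] would serve; dividing by [p + 1] covers [p = 0] as
     well. *)
  assert (Hd : 0 < eps / (p + 1)) by (apply Rdiv_lt_0_compat; lra).
  exists (exp (- (p * ln (eps / (p + 1))))). split; [ apply exp_pos | ].
  intros t Ht. rewrite <- exp_plus. apply exp_le.
  assert (H := ln_le_linear _ t Hd Ht).
  assert (p * (eps / (p + 1) * t) <= eps * t).
  { replace (p * (eps / (p + 1) * t)) with (eps * t * (p / (p + 1))) by (field; lra).
    assert (p / (p + 1) <= 1) by (apply Rle_div_l; lra).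
    assert (0 < eps * t) by nra. nra. }
  nra.
Qed.

Lemma rpow_at_right_0 (x : R) : 0 < x ->
  filterlim (fun t => exp (x * ln t)) (at_right 0) (locally 0).
Proof.
  intros Hx. apply filterlim_locally. intros eps.
  generalize (at_right_0_lt (exp (ln eps / x)) (exp_pos _)). apply filter_imp.
  intros t [Ht Hlt]. apply ln_increasing in Hlt; [ | exact Ht ]. rewrite ln_exp in Hlt.
  unfold ball; simpl; unfold AbsRing_ball, abs, minus, plus, opp; simpl.
  rewrite Ropp_0, Rplus_0_r, Rabs_pos_eq by (left; apply exp_pos).
  rewrite <- (exp_ln eps) by apply cond_pos. apply exp_increasing.
  apply Rlt_div_r in Hlt; lra.
Qed.

(** One explicit primitive controls both ends: with x = Re a, the function -M / (1 + t^x) has finite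
    limits at 0 and at infinity, and its derivative is M x t^(x-1) / (1 + t^x)^2. It dominates
    t^(x-1) e^(-t) because 1 + t^x <= (1 + K) e^(t/2), which fixes M = (1 + K)^2 / x. *)
Lemma ex_RInt_gen_Gamma (a : C) : 0 < Re a ->
  exists l : C, is_RInt_gen (V := C_R_NormedModule)
    (fun t => Rcpow t (a - 1) * RtoC (exp (- t)))%C (at_right 0) (Rbar_locally p_infty) l.
Proof.
  intros Ha. set (x := Re a) in *.
  destruct (rpow_le_exp x (1 / 2)) as [K [HK Hexp]]; [ lra | lra | ].
  set (M := (1 + K) ^ 2 / x).
  assert (HM : 0 < M) by (apply Rdiv_lt_0_compat; nra).
  apply (ex_RInt_gen_dominated _
    (fun t => - M / (1 + exp (x * ln t)))
    (fun t => M * (x * (/ t * exp (x * ln t))) / (1 + exp (x * ln t)) ^ 2)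
    (- M / (1 + 0)) 0).
  - intros t Ht. apply continuous_Cmult; [ now apply continuous_Rcpow | ].
    apply continuous_RtoC. apply (ex_derive_continuous (V := R_NormedModule)).
    auto_derive. auto.
  - intros t Ht. assert (He := exp_pos (x * ln t)). auto_derive.
    + split; [ exact Ht | split; [ lra | exact I ] ].
    + field. lra.
  - intros t Ht. assert (He := exp_pos (x * ln t)).
    apply (ex_derive_continuous (V := R_NormedModule)). auto_derive.
    repeat split; try lra. nra.
  - intros t Ht. assert (He := exp_pos (x * ln t)).
    rewrite Cmod_mult, Cmod_Rcpow, Cmod_R, Rabs_pos_eq by (left; apply exp_pos).
    replace (Re (a - 1) * ln t) with (x * ln t + - ln t) by (unfold x, Re; simpl; ring).
    rewrite exp_plus, (exp_Ropp (ln t)), exp_ln by exact Ht.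
    refine (proj1 (Rle_div_r _ _ _ _) _); [ apply pow_lt; lra | ].
    assert (H : (1 + exp (x * ln t)) ^ 2 <= (1 + K) ^ 2 * exp t).
    { replace (exp t) with (exp (1 / 2 * t) ^ 2)
        by (simpl; rewrite Rmult_1_r, <- exp_plus; f_equal; field).
      rewrite <- Rpow_mult_distr. apply pow_incr.
      specialize (Hexp t Ht). assert (H1 := exp_ineq1_le (1 / 2 * t)). nra. }
    replace (M * (x * (/ t * exp (x * ln t))))
      with (exp (x * ln t) * / t * exp (- t) * ((1 + K) ^ 2 * exp t)).
    + apply Rmult_le_compat_l; [ | exact H ].
      apply Rlt_le, Rmult_lt_0_compat; [ | apply exp_pos ].
      apply Rmult_lt_0_compat; [ exact He | now apply Rinv_0_lt_compat ].
    + unfold M. rewrite exp_Ropp. field. repeat split; try lra. apply Rgt_not_eq, exp_pos.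
  - apply (filterlim_comp _ _ _ (fun t => exp (x * ln t)) (fun u => - M / (1 + u))
             _ (locally 0)); [ now apply rpow_at_right_0 | ].
    apply (ex_derive_continuous (V := R_NormedModule) (fun u => - M / (1 + u))).
    auto_derive. lra.
  - apply filterlim_locally. intros eps.
    exists (exp (ln (M / eps) / x)). intros t Hlt.
    assert (Ht : 0 < t) by (eapply Rlt_trans; [ apply exp_pos | exact Hlt ]).
    apply ln_increasing in Hlt; [ | apply exp_pos ]. rewrite ln_exp in Hlt.
    apply Rlt_div_l in Hlt; [ | exact Ha ].
    rewrite Rmult_comm in Hlt. apply exp_increasing in Hlt.
    assert (Hp := cond_pos eps).
    rewrite exp_ln in Hlt by (apply Rdiv_lt_0_compat; lra).
    unfold ball; simpl; unfold AbsRing_ball, abs, minus, plus, opp; simpl.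
    rewrite Ropp_0, Rplus_0_r.
    assert (He := exp_pos (x * ln t)).
    replace (- M / (1 + exp (x * ln t))) with (- (M / (1 + exp (x * ln t)))) by (field; lra).
    rewrite Rabs_Ropp, Rabs_pos_eq by (left; apply Rdiv_lt_0_compat; lra).
    apply Rlt_div_l; [ lra | ]. apply Rlt_div_l in Hlt; [ | lra ]. nra.
Qed.

Lemma CGamma_unique (a l : C) :
  is_RInt_gen (V := C_R_NormedModule)
    (fun t => Rcpow t (a - 1) * RtoC (exp (- t)))%C (at_right 0) (Rbar_locally p_infty) l ->
  CGamma a = l.
Proof.
  intros H. unfold CGamma, CRInt_gen.
  exact (is_RInt_gen_unique (V := C_R_CompleteNormedModule) _ _ H).
Qed.

Lemma CGamma_correct (a : C) : 0 < Re a ->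
  is_RInt_gen (V := C_R_NormedModule)
    (fun t => Rcpow t (a - 1) * RtoC (exp (- t)))%C (at_right 0) (Rbar_locally p_infty)
    (CGamma a).
Proof.
  intros Ha. destruct (ex_RInt_gen_Gamma a Ha) as [l Hl].
  rewrite (CGamma_unique a l Hl). exact Hl.
Qed.

Lemma is_RInt_gen_ext_pos {V : NormedModule R_AbsRing} (f g : R -> V) (l : V) :
  (forall t, 0 < t -> f t = g t) ->
  is_RInt_gen f (at_right 0) (Rbar_locally p_infty) l ->
  is_RInt_gen g (at_right 0) (Rbar_locally p_infty) l.
Proof.
  intros H. apply is_RInt_gen_ext.
  generalize at_right_0_p_infty_pos. apply filter_imp. intros [a b]; simpl.
  intros Hab x Hx. apply H. rewrite Rmin_left in Hx by lra. lra.
Qed.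

Lemma is_RInt_gen_C_ext_pos (f g : R -> C) (l : C) :
  (forall t, 0 < t -> f t = g t) ->
  is_RInt_gen (V := C_R_NormedModule) f (at_right 0) (Rbar_locally p_infty) l ->
  is_RInt_gen (V := C_R_NormedModule) g (at_right 0) (Rbar_locally p_infty) l.
Proof. apply (is_RInt_gen_ext_pos (V := C_R_NormedModule)). Qed.

Lemma Rcpow_pred (t : R) (s : C) : 0 < t -> Rcpow t s = (RtoC t * Rcpow t (s - 1))%C.
Proof.
  intros Ht. rewrite <- (Rcpow_1 t Ht), <- Rcpow_plus. f_equal. ring.
Qed.

(** Integration by parts: [f] is the derivative of [F] = -t^a e^(-t), which tends to 0 at both ends,
    so the integral of [f] vanishes. *)
Lemma CGamma_succ (a : C) : 0 < Re a -> CGamma (a + 1) = (a * CGamma a)%C.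
Proof.
  intros Ha.
  set (F := fun t => (- (Rcpow t a * RtoC (exp (- t))))%C).
  set (f := fun t => (Rcpow t (a + 1 - 1) * RtoC (exp (- t))
              - a * (Rcpow t (a - 1) * RtoC (exp (- t))))%C).
  assert (Hc : forall t, 0 < t -> continuous (U := C_UniformSpace) f t).
  { intros t Ht. unfold f.
    assert (He : continuous (U := C_UniformSpace) (fun t => RtoC (exp (- t))) t)
      by (apply continuous_RtoC, (ex_derive_continuous (V := R_NormedModule)); auto_derive; auto).
    apply (continuous_minus (V := C_R_NormedModule)
             (fun t => Rcpow t (a + 1 - 1) * RtoC (exp (- t)))%C
             (fun t => a * (Rcpow t (a - 1) * RtoC (exp (- t))))%C).
    - apply continuous_Cmult; [ now apply continuous_Rcpow | exact He ].
    - apply (continuous_Cmult (fun _ => a)); [ apply continuous_const | ].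
      apply continuous_Cmult; [ now apply continuous_Rcpow | exact He ]. }
  assert (HF : is_RInt_gen (V := C_R_NormedModule) f (at_right 0) (Rbar_locally p_infty)
                 (RtoC 0 - RtoC 0)%C).
  { apply (is_RInt_gen_of_primitive f F).
    - intros u v Hu Hv.
      assert (Hm : forall t, Rmin u v <= t -> 0 < t)
        by (intros t; unfold Rmin; destruct (Rle_dec u v); lra).
      apply is_RInt_C.
      + apply (is_RInt_derive (V := R_CompleteNormedModule) (fun t => Re (F t))).
        * intros t [Ht _]. apply Hm in Ht. unfold f.
          apply (is_derive_ext (fun t => - (exp (Re a * ln t) * cos (Im a * ln t) * exp (- t)))).
          { intros r. unfold F. rewrite <- Re_Rcpow. unfold Re, Im; simpl. ring. }
          replace (a + 1 - 1)%C with a by ring.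
          replace (Rcpow t (a - 1)) with (/ RtoC t * Rcpow t a)%C
            by (rewrite (Rcpow_pred t a Ht); field; intros E; apply RtoC_inj in E; lra).
          rewrite <- RtoC_inv by lra.
          match goal with |- is_derive _ _ ?r => replace r with
            (Re (Rcpow t a) * exp (- t)
             - (Re a * Re (Rcpow t a) - Im a * Im (Rcpow t a)) / t * exp (- t))
            by (unfold Re, Im; simpl; field; lra) end.
          rewrite Re_Rcpow, Im_Rcpow. auto_derive; [ lra | field; lra ].
        * intros t [Ht _]. apply Hm in Ht. apply (filterlim_Re _ _ (Hc t Ht)).
      + apply (is_RInt_derive (V := R_CompleteNormedModule) (fun t => Im (F t))).
        * intros t [Ht _]. apply Hm in Ht. unfold f.
          apply (is_derive_ext (fun t => - (exp (Re a * ln t) * sin (Im a * ln t) * exp (- t)))).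
          { intros r. unfold F. rewrite <- Im_Rcpow. unfold Re, Im; simpl. ring. }
          replace (a + 1 - 1)%C with a by ring.
          replace (Rcpow t (a - 1)) with (/ RtoC t * Rcpow t a)%C
            by (rewrite (Rcpow_pred t a Ht); field; intros E; apply RtoC_inj in E; lra).
          rewrite <- RtoC_inv by lra.
          match goal with |- is_derive _ _ ?r => replace r with
            (Im (Rcpow t a) * exp (- t)
             - (Re a * Im (Rcpow t a) + Im a * Re (Rcpow t a)) / t * exp (- t))
            by (unfold Re, Im; simpl; field; lra) end.
          rewrite Re_Rcpow, Im_Rcpow. auto_derive; [ lra | field; lra ].
        * intros t [Ht _]. apply Hm in Ht. apply (filterlim_Im _ _ (Hc t Ht)).
    - apply filterlim_C_eps. intros eps Heps.
      assert (H := proj1 (filterlim_locally _ _) (rpow_at_right_0 (Re a) Ha) (mkposreal _ Heps)).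
      generalize (filter_and _ _ at_right_0_pos H). apply filter_imp. intros t [Ht Hb].
      unfold ball in Hb; simpl in Hb;
        unfold AbsRing_ball, abs, minus, plus, opp in Hb; simpl in Hb.
      rewrite Ropp_0, Rplus_0_r, Rabs_pos_eq in Hb by (left; apply exp_pos).
      unfold F. replace (- (Rcpow t a * RtoC (exp (- t))) - 0)%C
        with (- (Rcpow t a * RtoC (exp (- t))))%C by ring.
      rewrite Cmod_opp, Cmod_mult, Cmod_Rcpow, Cmod_R, Rabs_pos_eq by (left; apply exp_pos).
      assert (exp (- t) <= 1) by (rewrite <- exp_0; apply exp_le; lra).
      assert (P1 := exp_pos (Re a * ln t)). assert (P2 := exp_pos (- t)). nra.
    - apply filterlim_C_eps. intros eps Heps.
      destruct (rpow_le_exp (Re a) (1 / 2)) as [K [HK Hexp]]; [ lra | lra | ].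
      (* Here t^(Re a) e^(-t) <= K e^(-t/2), and e^(t/2) >= 1 + t/2 > K / eps once t > 2 K / eps. *)
      exists (Rmax 1 (2 * (K / eps))). intros t Hlt.
      assert (H1 := Rmax_l 1 (2 * (K / eps))). assert (H2 := Rmax_r 1 (2 * (K / eps))).
      assert (Ht : 0 < t) by lra.
      unfold F. replace (- (Rcpow t a * RtoC (exp (- t))) - 0)%C
        with (- (Rcpow t a * RtoC (exp (- t))))%C by ring.
      rewrite Cmod_opp, Cmod_mult, Cmod_Rcpow, Cmod_R, Rabs_pos_eq by (left; apply exp_pos).
      specialize (Hexp t Ht).
      assert (He : exp (- t) = / exp (1 / 2 * t) * / exp (1 / 2 * t)).
      { rewrite <- exp_Ropp, <- exp_plus. f_equal. field. }
      assert (P := exp_pos (1 / 2 * t)). assert (Q := exp_ineq1_le (1 / 2 * t)).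
      apply Rle_lt_trans with (K * exp (1 / 2 * t) * exp (- t)).
      { apply Rmult_le_compat_r; [ left; apply exp_pos | exact Hexp ]. }
      rewrite He.
      replace (K * exp (1 / 2 * t) * (/ exp (1 / 2 * t) * / exp (1 / 2 * t)))
        with (K / exp (1 / 2 * t)) by (field; lra).
      apply Rlt_div_l; [ exact P | ].
      assert (K / eps < exp (1 / 2 * t)) by lra.
      apply Rlt_div_l in H; lra. }
  assert (HG : is_RInt_gen (V := C_R_NormedModule)
     (fun t => Rcpow t (a + 1 - 1) * RtoC (exp (- t)))%C (at_right 0) (Rbar_locally p_infty)
     (RtoC 0 - RtoC 0 + a * CGamma a)%C).
  { apply is_RInt_gen_C_ext_pos
      with (fun t => f t + a * (Rcpow t (a - 1) * RtoC (exp (- t))))%C.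
    - intros t Ht. unfold f. ring.
    - apply (is_RInt_gen_plus (V := C_R_NormedModule)); [ exact HF | ].
      apply is_RInt_gen_Cmult. now apply CGamma_correct. }
  rewrite (CGamma_unique _ _ HG). ring.
Qed.

(** Substitution of [lam * t] for t in Euler's integral. This is the Mellin transform of a single
    exponential, the building block of the term-by-term integration. *)
Lemma is_RInt_gen_exp_scale (a : C) (lam : R) : 0 < Re a -> 0 < lam ->
  is_RInt_gen (V := C_R_NormedModule)
    (fun t => Rcpow t (a - 1) * RtoC (exp (- (lam * t))))%C
    (at_right 0) (Rbar_locally p_infty) (CGamma a * Rcpow lam (- a))%C.
Proof.
  intros Ha Hl.
  assert (Hlim : filterlim (fun t => lam * t) (Rbar_locally p_infty) (Rbar_locally p_infty)).
  { intros P [M HM]. exists (M / lam). intros t Ht. apply HM.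
    apply Rlt_div_l in Ht; lra. }
  assert (Hlim0 : filterlim (fun t => lam * t) (at_right 0) (at_right 0)).
  { intros P [eps HP].
    assert (He : 0 < eps / lam) by (apply Rdiv_lt_0_compat; [ apply cond_pos | lra ]).
    generalize (at_right_0_lt _ He). unfold filtermap. apply filter_imp.
    intros t [Ht Hlt]. apply Rlt_div_r in Hlt; [ | exact Hl ].
    apply HP; [ | nra ].
    unfold ball; simpl; unfold AbsRing_ball, abs, minus, plus, opp; simpl.
    rewrite Ropp_0, Rplus_0_r, Rabs_pos_eq; nra. }
  assert (H := is_RInt_gen_comp _ _ (fun _ => lam) _ (CGamma_correct a Ha) Hlim0 Hlim).
  assert (H' : is_RInt_gen (V := C_R_NormedModule)
    (fun t => RtoC lam * (Rcpow (lam * t) (a - 1) * RtoC (exp (- (lam * t)))))%C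
    (at_right 0) (Rbar_locally p_infty) (CGamma a)).
  { apply H. generalize at_right_0_p_infty_pos. apply filter_imp. intros [u v]; simpl.
    intros Huv x Hx. rewrite Rmin_left in Hx by lra. split; [ | split ].
    - apply continuous_Cmult.
      + apply continuous_Rcpow. nra.
      + apply continuous_RtoC, (ex_derive_continuous (V := R_NormedModule)).
        auto_derive; auto.
    - auto_derive; [ auto | ring ].
    - apply continuous_const. }
  apply (is_RInt_gen_Cmult (Rcpow lam (- a))) in H'.
  rewrite Cmult_comm. revert H'. apply is_RInt_gen_C_ext_pos. intros t Ht.
  rewrite Rcpow_mult by assumption.
  set (X := (Rcpow t (a - 1) * RtoC (exp (- (lam * t))))%C).
  transitivity (Rcpow lam a * Rcpow lam (- a) * X)%C.
  - rewrite (Rcpow_pred lam a Hl). unfold X. ring.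
  - rewrite Rcpow_opp. ring.
Qed.

Lemma CGamma_1 : CGamma 1 = 1%C.
Proof.
  apply CGamma_unique.
  apply is_RInt_gen_C_ext_pos with (fun t => RtoC (exp (- t))).
  { intros t Ht. replace (1 - 1)%C with (RtoC 0) by ring. rewrite Rcpow_0. ring. }
  assert (E : (RtoC 0 - RtoC (- 1))%C = 1%C) by (rewrite <- RtoC_minus; f_equal; ring).
  rewrite <- E.
  apply (is_RInt_gen_of_primitive _ (fun t => RtoC (- exp (- t)))).
  - intros u v _ _. apply is_RInt_C; simpl.
      apply (is_RInt_derive (V := R_CompleteNormedModule) (fun t => - exp (- t))).
      * intros t _. auto_derive; [ auto | ring ].
      * intros t _. apply (ex_derive_continuous (V := R_NormedModule)). auto_derive; auto.
    + replace (0 + - 0) with (scal (v - u) 0) by (unfold scal; simpl; unfold mult; simpl; ring).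
      apply (is_RInt_const (V := R_NormedModule)).
  - apply filterlim_C; simpl.
    + replace (- 1) with (- exp (- 0)) by (rewrite Ropp_0, exp_0; ring).
      apply (filterlim_filter_le_1 (G := at_right 0) (F := locally 0)
               (fun t => - exp (- t))); [ apply filter_le_within | ].
      apply (ex_derive_continuous (V := R_NormedModule) (fun t => - exp (- t))).
      auto_derive; auto.
    + apply filterlim_const.
  - apply filterlim_C; simpl.
    + apply filterlim_locally. intros eps. exists (- ln eps). intros t Ht.
      unfold ball; simpl; unfold AbsRing_ball, abs, minus, plus, opp; simpl.
      rewrite Ropp_0, Rplus_0_r, Rabs_Ropp, Rabs_pos_eq by (left; apply exp_pos).
      rewrite <- (exp_ln eps) by apply cond_pos. apply exp_increasing. lra.
    + apply filterlim_const.
Qed.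

(** * Gamma on the positive reals: positivity and log-convexity *)

Definition RGamma (x : R) : R := Re (CGamma (RtoC x)).

Lemma is_RInt_gen_RGamma (x : R) : 0 < x ->
  is_RInt_gen (fun t => exp ((x - 1) * ln t) * exp (- t)) (at_right 0) (Rbar_locally p_infty)
    (RGamma x).
Proof.
  intros Hx.
  apply is_RInt_gen_ext_pos
    with (fun t => Re (Rcpow t (RtoC x - 1) * RtoC (exp (- t)))).
  - intros t Ht. rewrite <- RtoC_minus, Rcpow_RtoC, <- RtoC_mult. reflexivity.
  - apply is_RInt_gen_Re. apply CGamma_correct. exact Hx.
Qed.

Lemma is_RInt_gen_zero_fct (f : R -> R) (l : R) :
  is_RInt_gen f (at_right 0) (Rbar_locally p_infty) l -> (forall t, 0 < t -> f t = 0) -> l = 0.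
Proof.
  intros H Hf.
  (* Scaling by 0 yields a zero integrand already known to be integrable, against which [f] is
     compared in both directions. *)
  assert (H0 : is_RInt_gen (fun t => scal 0 (f t)) (at_right 0) (Rbar_locally p_infty) (scal 0 l))
    by (apply (is_RInt_gen_scal (V := R_NormedModule)); exact H).
  assert (E : scal 0 l = 0) by apply Rmult_0_l. rewrite E in H0.
  apply Rle_antisym.
  - apply (is_RInt_gen_le_0_p_infty _ _ _ _ H H0).
    intros t Ht. rewrite Hf by exact Ht. right. symmetry. apply Rmult_0_r.
  - apply (is_RInt_gen_le_0_p_infty _ _ _ _ H0 H).
    intros t Ht. rewrite Hf by exact Ht. right. apply Rmult_0_r.
Qed.

Lemma CGamma_RtoC (x : R) : 0 < x -> CGamma (RtoC x) = RtoC (RGamma x).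
Proof.
  intros Hx. apply C_eq; [ reflexivity | ]. simpl.
  apply (is_RInt_gen_zero_fct _ _ (is_RInt_gen_Im _ _ (CGamma_correct (RtoC x) Hx))).
  intros t Ht. rewrite <- RtoC_minus, Rcpow_RtoC, <- RtoC_mult. reflexivity.
Qed.

Lemma RGamma_succ (x : R) : 0 < x -> RGamma (x + 1) = x * RGamma x.
Proof.
  intros Hx. unfold RGamma at 1. rewrite RtoC_plus, CGamma_succ by exact Hx.
  rewrite CGamma_RtoC by exact Hx. rewrite <- RtoC_mult. reflexivity.
Qed.

Lemma RGamma_fact (n : nat) : RGamma (INR n + 1) = INR (fact n).
Proof.
  induction n as [|n IH].
  - simpl. rewrite Rplus_0_l. unfold RGamma. rewrite CGamma_1. reflexivity.
  - rewrite S_INR, RGamma_succ by (generalize (pos_INR n); lra).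
    rewrite IH, fact_simpl, mult_INR, S_INR. reflexivity.
Qed.

(* Integrate (t^((y-x)/2) - lam)^2 t^(x-1) e^(-t) >= 0. *)
Lemma RGamma_midpoint (x y lam : R) : 0 < x -> 0 < y ->
  0 <= RGamma y - 2 * lam * RGamma ((x + y) / 2) + lam ^ 2 * RGamma x.
Proof.
  intros Hx Hy. assert (Hm : 0 < (x + y) / 2) by lra.
  assert (H1 := is_RInt_gen_RGamma x Hx). assert (H2 := is_RInt_gen_RGamma y Hy).
  assert (H3 := is_RInt_gen_RGamma _ Hm).
  assert (H0 := is_RInt_gen_scal (V := R_NormedModule) _ 0 _ H1).
  assert (H := is_RInt_gen_plus (V := R_NormedModule) _ _ _ _
                 (is_RInt_gen_minus (V := R_NormedModule) _ _ _ _ H2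
                    (is_RInt_gen_scal (V := R_NormedModule) _ (2 * lam) _ H3))
                 (is_RInt_gen_scal (V := R_NormedModule) _ (lam ^ 2) _ H1)).
  assert (L := is_RInt_gen_le_0_p_infty _ _ _ _ H0 H).
  unfold scal, minus, plus, opp in L; simpl in L; unfold mult in L; simpl in L.
  assert (L' : 0 * RGamma x <= RGamma y + - (2 * lam * RGamma ((x + y) / 2))
                               + lam * (lam * 1) * RGamma x).
  { apply L. intros t Ht.
    set (p := exp ((x - 1) / 2 * ln t)). set (q := exp ((y - 1) / 2 * ln t)).
    replace (exp ((x - 1) * ln t)) with (p * p)
      by (unfold p; rewrite <- exp_plus; f_equal; field).
    replace (exp ((y - 1) * ln t)) with (q * q)
      by (unfold q; rewrite <- exp_plus; f_equal; field).
    replace (exp (((x + y) / 2 - 1) * ln t)) with (p * q)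
      by (unfold p, q; rewrite <- exp_plus; f_equal; field).
    replace (q * q * exp (- t) + - (2 * lam * (p * q * exp (- t))) +
      lam * (lam * 1) * (p * p * exp (- t))) with ((q - lam * p)² * exp (- t))
      by (unfold Rsqr; ring).
    rewrite Rmult_0_l. apply Rmult_le_pos; [ apply Rle_0_sqr | left; apply exp_pos ]. }
  simpl. lra.
Qed.

(** The reflected point [y = 2 (n + 1) - x] makes the midpoint of x and y the integer n + 1, where
    Gamma is n! > 0. A quadratic in [lam] that stays nonnegative while its linear coefficient is
    nonzero must have a positive leading coefficient. *)
Lemma RGamma_pos (x : R) : 0 < x -> 0 < RGamma x.
Proof.
  intros Hx. destruct (INR_unbounded x) as [n Hn].
  assert (Hy : 0 < 2 * (INR n + 1) - x) by lra.
  assert (H := fun lam => RGamma_midpoint x _ lam Hx Hy).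
  replace ((x + (2 * (INR n + 1) - x)) / 2) with (INR n + 1) in H by field.
  rewrite RGamma_fact in H. set (A := RGamma (2 * (INR n + 1) - x)) in *.
  assert (Hf := INR_fact_lt_0 n). set (B := INR (fact n)) in *.
  assert (HA := H 0).
  (* At this [lam] the first two terms add up to -A - 2, which is negative by [HA]; the quadratic
     term has to compensate. *)
  specialize (H ((A + 1) / B)).
  replace (2 * ((A + 1) / B) * B) with (2 * (A + 1)) in H by (field; lra).
  assert (0 <= ((A + 1) / B) ^ 2) by apply pow2_ge_0.
  destruct (Rle_lt_dec (RGamma x) 0) as [Hle|]; [ | assumption ].
  assert (0 <= A) by lra. nra.
Qed.

(** The quadratic of [RGamma_midpoint] is taken at its minimum,
    [lam = RGamma ((x + y) / 2) / RGamma x], as in the proof of the Cauchy-Schwarz inequality. *)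
Lemma RGamma_log_convex (x y : R) : 0 < x -> 0 < y ->
  RGamma ((x + y) / 2) ^ 2 <= RGamma x * RGamma y.
Proof.
  intros Hx Hy. assert (P := RGamma_pos x Hx).
  assert (H := RGamma_midpoint x y (RGamma ((x + y) / 2) / RGamma x) Hx Hy).
  set (B := RGamma ((x + y) / 2)) in *. set (A := RGamma x) in *. set (D := RGamma y) in *.
  replace (D - 2 * (B / A) * B + (B / A) ^ 2 * A) with (D - B ^ 2 / A) in H by (field; lra).
  assert (H' : B ^ 2 / A <= D) by lra. apply Rle_div_l in H'; lra.
Qed.

(** * Non-vanishing of Gamma on the right half-plane *)

Lemma one_minus_sqr_le_cos (x : R) : 1 - x ^ 2 / 2 <= cos x.
Proof.
  assert (Hs : sin (x / 2) ^ 2 <= (x / 2) ^ 2).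
  { assert (Hp : forall v, 0 <= v -> sin v ^ 2 <= v ^ 2).
    { intros v [Hv|<-]; [ | rewrite sin_0; lra ].
      assert (H1 := sin_lt_x v Hv).
      destruct (Rle_lt_dec v 1) as [Hv1|Hv1].
      - assert (0 <= sin v) by (apply sin_ge_0; generalize PI2_1; lra). nra.
      - destruct (SIN_bound v). nra. }
    destruct (Rle_lt_dec 0 (x / 2)) as [H|H]; [ now apply Hp | ].
    assert (Hm := Hp (- (x / 2))). rewrite sin_neg in Hm. nra. }
  replace x with (2 * (x / 2)) at 2 by field. rewrite cos_2a_sin. nra.
Qed.

(** With r = e^w the right-hand side is (e^(w/2) - e^(-w/2))^2, and 2 v <= e^v - e^(-v) for v >= 0.
    A bound by r and 1/r is wanted because its mean against the Gamma density follows from the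
    functional equation alone. *)
Lemma ln_sqr_le (r : R) : 0 < r -> ln r ^ 2 <= r + / r - 2.
Proof.
  intros Hr.
  assert (Hp : forall v, 0 <= v -> 2 * v <= exp v - exp (- v)).
  { intros v Hv.
    destruct (MVT_gen (fun v => exp v - exp (- v) - 2 * v) 0 v
                (fun v => exp v + exp (- v) - 2)) as [c [_ Hc]].
    - intros x _. auto_derive; [ auto | ring ].
    - intros x _. apply continuity_pt_filterlim.
      apply (ex_derive_continuous (V := R_NormedModule) (fun v => exp v - exp (- v) - 2 * v)).
      auto_derive; auto.
    - simpl in Hc. rewrite Ropp_0, exp_0 in Hc.
      assert (0 <= exp c + exp (- c) - 2).
      { rewrite exp_Ropp. assert (P := exp_pos c).
        replace (exp c + / exp c - 2) with ((exp c - 1) ^ 2 / exp c) by (field; lra).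
        apply Rmult_le_pos; [ apply pow2_ge_0 | left; now apply Rinv_0_lt_compat ]. }
      nra. }
  set (w := ln r).
  assert (Er : r = exp (w / 2) * exp (w / 2)).
  { rewrite <- exp_plus. unfold w. replace (ln r / 2 + ln r / 2) with (ln r) by field.
    now rewrite exp_ln. }
  assert (Ei : / r = exp (- (w / 2)) * exp (- (w / 2))).
  { rewrite Er, exp_Ropp. field. apply Rgt_not_eq, exp_pos. }
  assert (E1 : exp (w / 2) * exp (- (w / 2)) = 1).
  { rewrite <- exp_plus, Rplus_opp_r. apply exp_0. }
  rewrite Ei, Er at 1.
  destruct (Rle_lt_dec 0 (w / 2)) as [H|H].
  - assert (H1 := Hp _ H). nra.
  - assert (H1 := Hp (- (w / 2))). rewrite Ropp_involutive in H1. nra.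
Qed.

Lemma CGamma_add_nat (a : C) (n : nat) : 0 < Re a -> CGamma a = 0%C ->
  CGamma (a + RtoC (INR n)) = 0%C.
Proof.
  intros Ha H0. induction n as [|n IH].
  - simpl. now rewrite Cplus_0_r.
  - rewrite S_INR, RtoC_plus, Cplus_assoc, CGamma_succ, IH; [ ring | ].
    unfold Re in *; simpl. generalize (pos_INR n). lra.
Qed.

(* A zero at a would give zeros at all a + n; but for large alpha = Re a + n the Gamma density
   t^(alpha-1) e^(-t) concentrates around t = alpha, where t^(iy) is nearly constant. *)
Lemma CGamma_neq_0 (a : C) : 0 < Re a -> CGamma a <> 0%C.
Proof.
  intros Ha H0. set (y := Im a). set (w := ((0, y) : C)).
  (* This ensures [alpha - 1 > y ^ 2 / 2], which is exactly the positivity of the final lower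
     bound. *)
  destruct (INR_unbounded (y ^ 2 / 2 + 1)) as [n Hn].
  assert (Hz := CGamma_add_nat a n Ha H0).
  set (b := (a + RtoC (INR n))%C) in *. set (alpha := Re a + INR n).
  assert (Hy2 := pow2_ge_0 y).
  assert (Hal : y ^ 2 / 2 < alpha - 1) by (unfold alpha; lra).
  assert (Hb : 0 < Re b) by (change (0 < alpha); lra).
  assert (H := CGamma_correct b Hb). rewrite Hz in H.
  (* The factor alpha^(-iy) turns t^(iy) into (t/alpha)^(iy), whose real part cos(y ln(t/alpha)) is
     near 1 around t = alpha. *)
  apply (is_RInt_gen_Cmult (Rcpow alpha (- w))) in H. rewrite Cmult_0_r in H.
  apply is_RInt_gen_Re in H.
  assert (H1 := is_RInt_gen_RGamma alpha ltac:(lra)).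
  assert (H2 := is_RInt_gen_RGamma (alpha + 1) ltac:(lra)).
  assert (H3 := is_RInt_gen_RGamma (alpha - 1) ltac:(lra)).
  (* Since cos v >= 1 - v^2/2 and ln(r)^2 <= r + 1/r - 2, the integrand is at least the density
     times 1 - (y^2/2)(t/alpha + alpha/t - 2). [HL] integrates this minorant; the functional
     equation reduces its value to Gamma(alpha-1) (alpha - 1 - y^2/2) > 0, which contradicts the
     zero. *)
  assert (HL := is_RInt_gen_minus (V := R_NormedModule) _ _ _ _
     (is_RInt_gen_scal (V := R_NormedModule) _ (1 + y ^ 2) _ H1)
     (is_RInt_gen_plus (V := R_NormedModule) _ _ _ _
       (is_RInt_gen_scal (V := R_NormedModule) _ (y ^ 2 / 2 / alpha) _ H2)
       (is_RInt_gen_scal (V := R_NormedModule) _ (y ^ 2 / 2 * alpha) _ H3))).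
  assert (L := is_RInt_gen_le_0_p_infty _ _ _ _ HL H).
  cbv beta in L. unfold minus, plus, opp, scal in L; simpl in L; unfold mult in L; simpl in L.
  assert (G1 := RGamma_succ alpha ltac:(lra)).
  assert (G2 := RGamma_succ (alpha - 1) ltac:(lra)).
  replace (alpha - 1 + 1) with alpha in G2 by ring.
  assert (P := RGamma_pos (alpha - 1) ltac:(lra)).
  rewrite G1, G2 in L.
  match type of L with _ -> ?A <= 0 =>
    replace A with (RGamma (alpha - 1) * (alpha - 1 - y ^ 2 / 2)) in L by (field; lra) end.
  assert (0 < RGamma (alpha - 1) * (alpha - 1 - y ^ 2 / 2)) by (apply Rmult_lt_0_compat; lra).
  enough (RGamma (alpha - 1) * (alpha - 1 - y ^ 2 / 2) <= 0) by lra.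
  apply L. intros t Ht. clear L.
  assert (Hal0 : 0 < alpha) by lra.
  set (k := exp ((alpha - 1) * ln t)). set (e := exp (- t)).
  replace (exp ((alpha + 1 - 1) * ln t)) with (t * k)
    by (unfold k; rewrite <- (exp_ln t Ht) at 1; rewrite <- exp_plus; f_equal; ring).
  replace (exp ((alpha - 1 - 1) * ln t)) with (/ t * k).
  2:{ unfold k. rewrite <- (exp_ln t Ht) at 1. rewrite <- exp_Ropp, <- exp_plus. f_equal; ring. }
  assert (E : Re (Rcpow alpha (- w) * (Rcpow t (b - 1) * RtoC e))
              = k * e * cos (y * ln (t / alpha))).
  { assert (Eb : Rcpow t (b - 1) = (RtoC k * Rcpow t w)%C).
    { unfold k. rewrite <- Rcpow_RtoC, <- Rcpow_plus. f_equal.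
      apply C_eq; unfold w, b, alpha, y, Re, Im; simpl; ring. }
    rewrite Eb.
    replace (Rcpow alpha (- w) * (RtoC k * Rcpow t w * RtoC e))%C
      with (RtoC (k * e) * (Rcpow alpha (- w) * Rcpow t w))%C by (rewrite RtoC_mult; ring).
    replace (Re (RtoC (k * e) * (Rcpow alpha (- w) * Rcpow t w)))
      with (k * e * (Re (Rcpow alpha (- w)) * Re (Rcpow t w)
                 - Im (Rcpow alpha (- w)) * Im (Rcpow t w)))
      by (unfold Re, Im; simpl; ring).
    rewrite !Re_Rcpow, !Im_Rcpow. unfold w, Re, Im; simpl.
    rewrite Ropp_0, !Rmult_0_l, exp_0, ln_div by assumption.
    replace (y * (ln t - ln alpha)) with (- y * ln alpha + y * ln t) by ring.
    rewrite cos_plus. ring. }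
  match goal with |- _ <= ?r => replace r with (k * e * cos (y * ln (t / alpha))) end.
  assert (Hc := one_minus_sqr_le_cos (y * ln (t / alpha))).
  assert (Hr : 0 < t / alpha) by now apply Rdiv_lt_0_compat.
  assert (Hl := ln_sqr_le _ Hr).
  assert (Hk : 0 < k) by apply exp_pos. assert (He : 0 < e) by apply exp_pos.
  match goal with |- ?A <= _ =>
    replace A with (k * e * (1 - y ^ 2 / 2 * (t / alpha + / (t / alpha) - 2))) by (field; lra) end.
  apply Rmult_le_compat_l; [ nra | ].
  eapply Rle_trans; [ | exact Hc ]. rewrite Rpow_mult_distr. nra.
Qed.

(** * Wallis' integrals and the value of Gamma at 1/2 *)

(* The Taylor coefficients in y = x^2 of 1/sqrt(1-x^2) and of arcsin x / (x sqrt(1-x^2)), namely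
   (2m-1)!!/(2m)!! and (2m)!!/(2m+1)!!. *)
Fixpoint invsqrt_coef (m : nat) : R :=
  match m with O => 1 | S k => invsqrt_coef k * ((2 * INR k + 1) / (2 * INR k + 2)) end.

Fixpoint arcsin_coef (m : nat) : R :=
  match m with O => 1 | S k => arcsin_coef k * ((2 * INR k + 2) / (2 * INR k + 3)) end.

Lemma invsqrt_coef_succ (m :
  nat) : (2 * INR m + 2) * invsqrt_coef (S m) = (2 * INR m + 1) * invsqrt_coef m.
Proof. generalize (pos_INR m); intros H. simpl. field. lra. Qed.

Lemma arcsin_coef_succ (m :
  nat) : (2 * INR m + 3) * arcsin_coef (S m) = (2 * INR m + 2) * arcsin_coef m.
Proof. generalize (pos_INR m); intros H. simpl. field. lra. Qed.

Lemma invsqrt_coef_bound (m : nat) : 0 < invsqrt_coef m <= 1.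
Proof.
  induction m as [|m IH]; [ simpl; lra | ].
  generalize (pos_INR m) (invsqrt_coef_succ m); intros H E. split; nra.
Qed.

Lemma arcsin_coef_bound (m : nat) : 0 < arcsin_coef m <= 1.
Proof.
  induction m as [|m IH]; [ simpl; lra | ].
  generalize (pos_INR m) (arcsin_coef_succ m); intros H E. split; nra.
Qed.

(** The double factorials cancel. The two coefficient sequences are thus reciprocal up to 2m + 1, so
    a central binomial can be moved from a denominator to a numerator. *)
Lemma arcsin_coef_invsqrt_coef (m : nat) : (2 * INR m + 1) * (arcsin_coef m * invsqrt_coef m) = 1.
Proof.
  induction m as [|m IH]; [ simpl; lra | ].
  generalize (pos_INR m); intros H.
  transitivity ((2 * INR m + 1) * (arcsin_coef m * invsqrt_coef m)); [ | exact IH ].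
  replace (2 * INR (S m) + 1) with (2 * INR m + 3) by (rewrite S_INR; ring).
  simpl. field. lra.
Qed.

Lemma invsqrt_coef_fact (m :
  nat) : invsqrt_coef m * (4 ^ m * INR (fact m) ^ 2) = INR (fact (2 * m)).
Proof.
  induction m as [|m IH]; [ simpl; lra | ].
  replace (2 * S m)%nat with (S (S (2 * m))) by lia.
  rewrite !fact_simpl, !mult_INR, <- IH, !S_INR, mult_INR.
  simpl. generalize (pos_INR m); intros H. field. lra.
Qed.

Definition wallis (n : nat) : R := RInt (fun x => sin x ^ n) 0 (PI / 2).

Lemma ex_RInt_sin_pow (n : nat) (a b : R) : ex_RInt (fun x => sin x ^ n) a b.
Proof.
  apply (ex_RInt_continuous (V := R_CompleteNormedModule)). intros x _.
  apply (ex_derive_continuous (V := R_NormedModule)). auto_derive. auto.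
Qed.

(** The integrand of the difference is the derivative of -cos x sin^(n+1) x, which vanishes at 0 and
    at PI/2. *)
Lemma wallis_rec (n : nat) : (INR n + 2) * wallis (S (S n)) = (INR n + 1) * wallis n.
Proof.
  assert (HPI := PI_RGT_0).
  assert (H : is_RInt (fun x => (INR n + 2) * sin x ^ S (S n) - (INR n + 1) * sin x ^ n)
                0 (PI / 2)
                ((INR n + 2) * wallis (S (S n)) - (INR n + 1) * wallis n)).
  { apply (is_RInt_minus (V := R_NormedModule)); apply (is_RInt_scal (V := R_NormedModule));
      apply (RInt_correct (V := R_CompleteNormedModule)), ex_RInt_sin_pow. }
  assert (H' : is_RInt (fun x => (INR n + 2) * sin x ^ S (S n) - (INR n + 1) * sin x ^ n)
                0 (PI / 2)
                (minus (- cos (PI / 2) * sin (PI / 2) ^ S n) (- cos 0 * sin 0 ^ S n))).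
  { apply (is_RInt_derive (V := R_CompleteNormedModule) (fun x => - cos x * sin x ^ S n)).
    - intros x _. apply is_derive_Reals.
      replace ((INR n + 2) * sin x ^ S (S n) - (INR n + 1) * sin x ^ n)
        with (sin x * sin x ^ S n + - cos x * (INR (S n) * sin x ^ n * cos x)).
      + apply is_derive_Reals.
        apply (is_derive_mult (K := R_AbsRing) (fun x => - cos x) (fun x => sin x ^ S n)).
        * auto_derive; [ auto | ring ].
        * apply is_derive_Reals.
          replace (INR (S n) * sin x ^ n * cos x)
            with (INR (S n) * cos x * sin x ^ pred (S n)) by (simpl pred; ring).
          apply is_derive_Reals. apply is_derive_pow. apply is_derive_Reals, derivable_pt_lim_sin.
        * intros; apply Rmult_comm.
      + assert (E := sin2_cos2 x). unfold Rsqr in E. rewrite S_INR. simpl.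
        replace (- cos x * ((INR n + 1) * sin x ^ n * cos x))
          with (- (INR n + 1) * sin x ^ n * (1 - sin x * sin x)) by (rewrite <- E; ring).
        ring.
    - intros x _. apply (ex_derive_continuous (V := R_NormedModule)). auto_derive. auto. }
  assert (E := is_RInt_unique _ _ _ _ H). rewrite (is_RInt_unique _ _ _ _ H') in E.
  rewrite cos_PI2, sin_0 in E. unfold minus, plus, opp in E; simpl in E. lra.
Qed.

Lemma wallis_decr (n : nat) : wallis (S n) <= wallis n.
Proof.
  assert (HPI := PI_RGT_0).
  apply RInt_le; [ lra | apply ex_RInt_sin_pow | apply ex_RInt_sin_pow | ].
  intros x Hx. assert (0 < sin x) by (apply sin_gt_0; lra).
  assert (0 <= sin x ^ n) by (apply pow_le; lra). destruct (SIN_bound x). simpl. nra.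
Qed.

Lemma wallis_even (m : nat) : wallis (2 * m) = PI / 2 * invsqrt_coef m.
Proof.
  induction m as [|m IH].
  - simpl. unfold wallis. simpl. rewrite RInt_const.
    unfold scal; simpl; unfold mult; simpl. ring.
  - replace (2 * S m)%nat with (S (S (2 * m))) by lia.
    assert (E := wallis_rec (2 * m)). rewrite IH, mult_INR in E.
    assert (F := invsqrt_coef_succ m). assert (P := pos_INR m).
    replace (INR 2) with 2 in E by reflexivity.
    apply Rmult_eq_reg_l with (2 * INR m + 2); [ | lra ]. rewrite E.
    replace ((2 * INR m + 2) * (PI / 2 * invsqrt_coef (S m)))
      with (PI / 2 * ((2 * INR m + 2) * invsqrt_coef (S m))) by ring.
    rewrite F. ring.
Qed.

Lemma wallis_odd (m : nat) : wallis (2 * m + 1) = arcsin_coef m.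
Proof.
  induction m as [|m IH].
  - simpl. unfold wallis.
    assert (H : is_RInt (fun x => sin x ^ 1) 0 (PI / 2) (minus (- cos (PI / 2)) (- cos 0))).
    { apply (is_RInt_derive (V := R_CompleteNormedModule) (fun x => - cos x)).
      - intros x _. auto_derive; [ auto | ring ].
      - intros x _. apply (ex_derive_continuous (V := R_NormedModule)). auto_derive. auto. }
    rewrite (is_RInt_unique _ _ _ _ H), cos_PI2, cos_0.
    unfold minus, plus, opp; simpl; ring.
  - replace (2 * S m + 1)%nat with (S (S (2 * m + 1))) by lia.
    assert (E := wallis_rec (2 * m + 1)). rewrite IH, plus_INR, mult_INR in E.
    assert (F := arcsin_coef_succ m). assert (P := pos_INR m).
    replace (INR 2) with 2 in E by reflexivity. replace (INR 1) with 1 in E by reflexivity.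
    apply Rmult_eq_reg_l with (2 * INR m + 3); [ | lra ]. rewrite F. lra.
Qed.

(** Write a for [invsqrt_coef m] and W for [wallis]. Then W(2m) = (PI/2) a and W(2m+1) = 1/((2m+1)
    a), and W(2m+1) <= W(2m) <= W(2m-1) gives the two bounds. *)
Lemma PI_invsqrt_coef_bounds (m : nat) : (1 <= m)%nat ->
  PI * invsqrt_coef m ^ 2 * INR m <= 1 <= PI * invsqrt_coef m ^ 2 * (INR m + 1 / 2).
Proof.
  intros Hm. assert (B := invsqrt_coef_bound m). assert (D := arcsin_coef_invsqrt_coef m).
  assert (P := pos_INR m).
  split.
  - destruct m as [|k]; [ lia | ].
    assert (H := wallis_decr (2 * k + 1)).
    replace (S (2 * k + 1)) with (2 * S k)%nat in H by lia.
    rewrite wallis_even, wallis_odd in H.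
    assert (Dk := arcsin_coef_invsqrt_coef k). assert (Fk := invsqrt_coef_succ k).
    assert (Pk := pos_INR k).
    rewrite S_INR.
    apply Rle_trans with (2 * (INR k + 1) * (arcsin_coef k * invsqrt_coef (S k))).
    + replace (PI * invsqrt_coef (S k) ^ 2 * (INR k + 1))
        with (2 * (INR k + 1) * (PI / 2 * invsqrt_coef (S k) * invsqrt_coef (S k))) by field.
      apply Rmult_le_compat_l; [ lra | ]. apply Rmult_le_compat_r; lra.
    + right. transitivity ((2 * INR k + 1) * (arcsin_coef k * invsqrt_coef k)); [ | exact Dk ].
      replace (2 * (INR k + 1) * (arcsin_coef k * invsqrt_coef (S k)))
        with (arcsin_coef k * ((2 * INR k + 2) * invsqrt_coef (S k))) by ring.
      rewrite Fk. ring.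
  - assert (H := wallis_decr (2 * m)). replace (S (2 * m)) with (2 * m + 1)%nat in H by lia.
    rewrite wallis_even, wallis_odd in H.
    apply Rle_trans with ((2 * INR m + 1) * (PI / 2 * invsqrt_coef m * invsqrt_coef m));
      [ | right; field ].
    rewrite <- D at 1. apply Rmult_le_compat_l; [ lra | ]. apply Rmult_le_compat_r; lra.
Qed.

Lemma RGamma_half (m : nat) :
  RGamma (INR m + 1 / 2) = RGamma (1 / 2) * (invsqrt_coef m * INR (fact m)).
Proof.
  induction m as [|m IH].
  - simpl. rewrite Rplus_0_l. ring.
  - rewrite S_INR. replace (INR m + 1 + 1 / 2) with (INR m + 1 / 2 + 1) by ring.
    assert (P := pos_INR m).
    rewrite RGamma_succ, IH, fact_simpl, mult_INR, S_INR by lra. simpl. field. lra.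
Qed.

(** These are the Wallis bounds with Gamma(1/2)^2 in the place of PI. They come from log-convexity
    at the midpoint m + 1/2 of m and m + 1, and at the midpoint m + 1 of m + 1/2 and m + 3/2. *)
Lemma RGamma_half_bounds (m : nat) : (1 <= m)%nat ->
  RGamma (1 / 2) ^ 2 * invsqrt_coef m ^ 2 * INR m <= 1 <=
  RGamma (1 / 2) ^ 2 * invsqrt_coef m ^ 2 * (INR m + 1 / 2).
Proof.
  intros Hm. destruct m as [|k]; [ lia | ].
  assert (Pk := pos_INR k). assert (F := INR_fact_lt_0 k).
  assert (F' := INR_fact_lt_0 (S k)).
  split.
  - assert (H := RGamma_log_convex (INR k + 1) (INR (S k) + 1) ltac:(lra)
                   ltac:(rewrite S_INR; lra)).
    rewrite !RGamma_fact in H.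
    replace ((INR k + 1 + (INR (S k) + 1)) / 2) with (INR (S k) + 1 / 2) in H
      by (rewrite S_INR; field).
    rewrite RGamma_half, fact_simpl, mult_INR in H.
    set (x := RGamma (1 / 2) ^ 2 * invsqrt_coef (S k) ^ 2 * INR (S k)).
    assert (E : x * (INR (S k) * INR (fact k) ^ 2) <= 1 * (INR (S k) * INR (fact k) ^ 2)).
    { unfold x.
      replace (RGamma (1 / 2) ^ 2 * invsqrt_coef (S k) ^ 2 * INR (S k)
               * (INR (S k) * INR (fact k) ^ 2))
        with ((RGamma (1 / 2) * (invsqrt_coef (S k) * (INR (S k) * INR (fact k)))) ^ 2) by ring.
      eapply Rle_trans; [ exact H | right; ring ]. }
    apply Rmult_le_reg_r in E; [ exact E | ].
    apply Rmult_lt_0_compat; [ apply lt_0_INR; lia | apply pow_lt; exact F ].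
  - assert (H := RGamma_log_convex (INR (S k) + 1 / 2) (INR (S k) + 1 / 2 + 1)
                   ltac:(rewrite S_INR; lra) ltac:(rewrite S_INR; lra)).
    replace ((INR (S k) + 1 / 2 + (INR (S k) + 1 / 2 + 1)) / 2) with (INR (S k) + 1) in H by field.
    rewrite RGamma_fact, RGamma_succ, RGamma_half in H by (rewrite S_INR; lra).
    set (x := RGamma (1 / 2) ^ 2 * invsqrt_coef (S k) ^ 2 * (INR (S k) + 1 / 2)).
    assert (E : 1 * INR (fact (S k)) ^ 2 <= x * INR (fact (S k)) ^ 2).
    { rewrite Rmult_1_l. eapply Rle_trans; [ exact H | right; unfold x; ring ]. }
    apply Rmult_le_reg_r in E; [ exact E | ]. apply pow_lt; exact F'.
Qed.

(** Cancelling [c m] leaves a m <= b (m + 1/2) for every m >= 1, which fails for m > b / (a - b) if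
    a > b. Used in both directions, it identifies two constants subject to the same bounds. *)
Lemma le_of_scaled_bounds (a b : R) (c : nat -> R) : 0 <= b ->
  (forall m, (1 <= m)%nat -> 0 < c m) ->
  (forall m, (1 <= m)%nat -> a * c m * INR m <= 1) ->
  (forall m, (1 <= m)%nat -> 1 <= b * c m * (INR m + 1 / 2)) -> a <= b.
Proof.
  intros Hb Hc Ha H. apply Rnot_lt_le. intros Hlt.
  destruct (INR_unbounded (Rmax 1 (b / (a - b)))) as [m Hm].
  assert (M1 := Rmax_l 1 (b / (a - b))). assert (M2 := Rmax_r 1 (b / (a - b))).
  assert (H1 : (1 <= m)%nat) by (apply INR_le; simpl; lra).
  assert (E : a * INR m <= b * (INR m + 1 / 2)).
  { apply Rmult_le_reg_r with (c m); [ now apply Hc | ].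
    specialize (Ha m H1). specialize (H m H1). lra. }
  assert (b / (a - b) < INR m) by lra. apply Rlt_div_l in H0; lra.
Qed.

Lemma RGamma_half_sqr : RGamma (1 / 2) ^ 2 = PI.
Proof.
  assert (HPI := PI_RGT_0). assert (HG := pow2_ge_0 (RGamma (1 / 2))).
  assert (Hc : forall m, (1 <= m)%nat -> 0 < invsqrt_coef m ^ 2)
    by (intros m _; apply pow_lt, invsqrt_coef_bound).
  apply Rle_antisym; apply (le_of_scaled_bounds _ _ (fun m => invsqrt_coef m ^ 2)); try lra;
    try exact Hc; intros m Hm;
    first [ now apply RGamma_half_bounds | now apply PI_invsqrt_coef_bounds ].
Qed.

(** The square of Gamma(m + 3/2) contributes Gamma(1/2)^2 = PI, the constant that later cancels the
    denominator of sigma / PI. *)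
Lemma half_binom_eq (m : nat) :
  half_binom m = RtoC (2 ^ (2 * m + 1) / (PI * invsqrt_coef m * (INR m + 1 / 2))).
Proof.
  assert (P := pos_INR m). assert (F := invsqrt_coef_bound m). assert (HPI := PI_RGT_0).
  unfold half_binom.
  replace (2 * INR m + 2) with (INR (2 * m + 1) + 1)
    by (rewrite plus_INR, mult_INR; simpl; ring).
  replace (INR m + 3 / 2) with (INR m + 1 / 2 + 1) by field.
  assert (P' := pos_INR (2 * m + 1)).
  assert (Q := RGamma_pos (INR m + 1 / 2 + 1) ltac:(lra)).
  rewrite !CGamma_RtoC, RGamma_fact by lra.
  rewrite <- RtoC_pow, <- RtoC_div. 2:{ apply pow_nonzero; lra. }
  f_equal. rewrite RGamma_succ, RGamma_half by lra.
  replace (((INR m + 1 / 2) * (RGamma (1 / 2) * (invsqrt_coef m * INR (fact m)))) ^ 2)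
    with (RGamma (1 / 2) ^ 2 * ((INR m + 1 / 2) * invsqrt_coef m * INR (fact m)) ^ 2) by ring.
  rewrite RGamma_half_sqr.
  replace (2 * m + 1)%nat with (S (2 * m)) by lia.
  rewrite fact_simpl, mult_INR, <- invsqrt_coef_fact, S_INR, mult_INR.
  replace (2 ^ S (2 * m)) with (2 * 4 ^ m)
    by (rewrite <- tech_pow_Rmult, pow_mult; f_equal; f_equal; ring).
  assert (G := INR_fact_lt_0 m). simpl. field. repeat split; lra.
Qed.

(** The binomial is 4^(k+1) [invsqrt_coef (S k)]; it is written with the reciprocal of
    [arcsin_coef k] because the zeta series divides by it. *)
Lemma central_binom_eq (k : nat) :
  Binomial.C (2 * S k) (S k) = 4 ^ S k / (2 * (INR k + 1) * arcsin_coef k).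
Proof.
  unfold Binomial.C. replace (2 * S k - S k)%nat with (S k) by lia.
  rewrite <- invsqrt_coef_fact.
  assert (P := pos_INR k). assert (F := INR_fact_lt_0 (S k)). assert (D := arcsin_coef_bound k).
  assert (E := arcsin_coef_invsqrt_coef k). assert (S' := invsqrt_coef_succ k).
  assert (H : invsqrt_coef (S k) * (2 * (INR k + 1) * arcsin_coef k) = 1).
  { transitivity ((2 * INR k + 1) * (arcsin_coef k * invsqrt_coef k)); [ | exact E ].
    replace (invsqrt_coef (S k) * (2 * (INR k + 1) * arcsin_coef k))
      with (arcsin_coef k * ((2 * INR k + 2) * invsqrt_coef (S k))) by ring. rewrite S'. ring. }
  replace (invsqrt_coef (S k)) with (/ (2 * (INR k + 1) * arcsin_coef k)).
  - field. repeat split; lra.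
  - apply Rmult_eq_reg_r with (2 * (INR k + 1) * arcsin_coef k); [ rewrite H; field; lra | nra ].
Qed.

(** * The power series of 1/cos t and t/(sin t cos t) in sin^2 t *)

Lemma CV_radius_bounded_by_1 (a : nat -> R) (y : R) :
  (forall m, 0 < a m <= 1) -> Rabs y < 1 -> Rbar_lt (Rabs y) (CV_radius a).
Proof.
  intros Ha Hy. apply Rbar_lt_le_trans with 1; [ exact Hy | ].
  apply (proj1 (CV_radius_bounded a)). exists 1. intros n.
  rewrite pow1, Rmult_1_r, Rabs_pos_eq; apply Ha || (left; apply Ha).
Qed.

(** The coefficient recursion read as the equation 2 (1 - y) f' = f, whose solution with f(0) = 1 is
    (1 - y)^(-1/2). *)
Lemma PSeries_invsqrt_coef_ode (y : R) : Rabs y < 1 ->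
  2 * (1 - y) * PSeries (PS_derive invsqrt_coef) y = PSeries invsqrt_coef y.
Proof.
  intros Hy. assert (Hr := CV_radius_bounded_by_1 invsqrt_coef y invsqrt_coef_bound Hy).
  assert (He := ex_pseries_derive _ _ Hr).
  rewrite (PSeries_ext invsqrt_coef
    (PS_minus (PS_scal 2 (PS_derive invsqrt_coef))
       (PS_scal 2 (PS_incr_1 (PS_derive invsqrt_coef))))).
  - rewrite PSeries_minus, !PSeries_scal, PSeries_incr_1.
    + ring.
    + apply ex_pseries_scal; [ apply Rmult_comm | exact He ].
    + apply ex_pseries_scal; [ apply Rmult_comm | now apply ex_pseries_incr_1 ].
  - intros n. unfold PS_minus, PS_plus, PS_opp, PS_scal, PS_derive, PS_incr_1.
    unfold plus, opp, scal; simpl; unfold mult; simpl.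
    assert (F := invsqrt_coef_succ n).
    change (invsqrt_coef n * ((2 * INR n + 1) / (2 * INR n + 2))) with (invsqrt_coef (S n)).
    set (x := invsqrt_coef (S n)) in *. clearbody x. destruct n as [|n].
    + simpl in F |- *. unfold zero; simpl. lra.
    + change (match n with O => 1 | S _ => INR n + 1 end) with (INR (S n)).
      change (invsqrt_coef n * ((2 * INR n + 1) / (2 * INR n + 2))) with (invsqrt_coef (S n)).
      change (match S n with O => 1 | S _ => INR (S n) + 1 end) with (INR (S (S n))).
      rewrite !S_INR in *. lra.
Qed.

Lemma PSeries_arcsin_coef_ode (y : R) : Rabs y < 1 ->
  (1 - 2 * y) * PSeries arcsin_coef y + 2 * y * (1 - y) * PSeries (PS_derive arcsin_coef) y = 1.
Proof.
  intros Hy. assert (Hr := CV_radius_bounded_by_1 arcsin_coef y arcsin_coef_bound Hy).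
  assert (H0 := CV_radius_inside _ _ Hr).
  assert (He := ex_pseries_derive _ _ Hr).
  set (u := PS_incr_1 (PS_derive arcsin_coef)).
  assert (Hu : ex_pseries u y) by now apply ex_pseries_incr_1.
  assert (Eu : PSeries u y = y * PSeries (PS_derive arcsin_coef) y) by apply PSeries_incr_1.
  assert (un : forall n, u n = INR n * arcsin_coef n).
  { intros [|n]; [ unfold u; simpl; unfold zero; simpl; ring | reflexivity ]. }
  clearbody u.
  (* [u] has coefficients n c_n, so [A] has (2n+1) c_n. By the recursion, [A] shifted down by one
     has (2n+2) c_n, the coefficients of twice the sum of the series and [u]. *)
  set (A := PS_plus arcsin_coef (PS_scal 2 u)).
  assert (Hs : ex_pseries (PS_scal 2 u) y)
    by (apply ex_pseries_scal; [ apply Rmult_comm | exact Hu ]).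
  assert (EA : PSeries A y = PSeries arcsin_coef y + 2 * PSeries u y)
    by (unfold A; rewrite PSeries_plus, PSeries_scal; auto).
  assert (ED : PSeries A y = 1 + y * (2 * (PSeries arcsin_coef y + PSeries u y))).
  { rewrite PSeries_decr_1.
    - f_equal.
      + unfold A, PS_plus, PS_scal, plus, scal; simpl; unfold mult; simpl. rewrite un. simpl. ring.
      + f_equal. rewrite (PSeries_ext _ (PS_scal 2 (PS_plus arcsin_coef u))).
        * rewrite PSeries_scal, PSeries_plus; auto.
        * intros n. unfold PS_decr_1, A, PS_plus, PS_scal, plus, scal; simpl; unfold mult; simpl.
          rewrite !un. assert (D := arcsin_coef_succ n). rewrite S_INR.
          change (arcsin_coef n * ((2 * INR n + 2) / (2 * INR n + 3))) with (arcsin_coef (S n)).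
          lra.
    - apply ex_pseries_plus; assumption. }
  rewrite EA, Eu in ED. lra.
Qed.

Lemma const_of_zero_derive (K dK : R -> R) (a b : R) : a <= b ->
  (forall x, a <= x <= b -> is_derive K x (dK x)) -> (forall x, a <= x <= b -> dK x = 0) ->
  K b = K a.
Proof.
  intros Hab HK H0.
  destruct (MVT_gen K a b dK) as [c [Hc E]].
  - intros x Hx. rewrite Rmin_left, Rmax_right in Hx by exact Hab. apply HK. lra.
  - intros x Hx. rewrite Rmin_left, Rmax_right in Hx by exact Hab.
    apply continuity_pt_filterlim. apply (ex_derive_continuous (V := R_NormedModule) K).
    eexists. apply HK. exact Hx.
  - rewrite Rmin_left, Rmax_right in Hc by exact Hab. rewrite H0 in E by exact Hc. lra.
Qed.

Lemma sin_sqr_lt_1 (t : R) : 0 <= t < PI / 2 -> 0 < cos t /\ Rabs (sin t ^ 2) < 1.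
Proof.
  intros Ht. assert (Hc : 0 < cos t) by (apply cos_gt_0; lra). split; [ exact Hc | ].
  assert (E := sin2_cos2 t). unfold Rsqr in E.
  rewrite Rabs_pos_eq by apply pow2_ge_0. simpl. nra.
Qed.

(** By the differential equation at y = sin^2 t the left-hand side has zero derivative, and it
    equals 1 at t = 0. *)
Lemma cos_PSeries_invsqrt_coef (t :
  R) : 0 <= t < PI / 2 -> cos t * PSeries invsqrt_coef (sin t ^ 2) = 1.
Proof.
  intros Ht.
  assert (E : cos t * PSeries invsqrt_coef (sin t ^ 2) = cos 0 * PSeries invsqrt_coef (sin 0 ^ 2)).
  { apply (const_of_zero_derive (fun t => cos t * PSeries invsqrt_coef (sin t ^ 2))
      (fun t => - sin t * PSeries invsqrt_coef (sin t ^ 2)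
         + cos t * ((2 * sin t * cos t) * PSeries (PS_derive invsqrt_coef) (sin t ^ 2))));
      [ lra | | ].
    - intros x Hx. destruct (sin_sqr_lt_1 x) as [Hc Hs]; [ lra | ].
      apply (is_derive_mult (K := R_AbsRing) cos (fun t => PSeries invsqrt_coef (sin t ^ 2))).
      + apply is_derive_Reals, derivable_pt_lim_cos.
      + apply (is_derive_comp (V := R_NormedModule) (PSeries invsqrt_coef) (fun t => sin t ^ 2)).
        * apply is_derive_PSeries, CV_radius_bounded_by_1; [ apply invsqrt_coef_bound | exact Hs ].
        * auto_derive; [ auto | ring ].
      + intros; apply Rmult_comm.
    - intros x Hx. destruct (sin_sqr_lt_1 x) as [Hc Hs]; [ lra | ].
      rewrite <- (PSeries_invsqrt_coef_ode _ Hs).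
      assert (E := sin2_cos2 x). unfold Rsqr in E.
      replace (1 - sin x ^ 2) with (cos x * cos x) by (rewrite <- E; ring). ring. }
  rewrite E, sin_0, cos_0. replace (0 ^ 2) with 0 by ring. rewrite PSeries_0. simpl. ring.
Qed.

(** With y = sin^2 t, the derivative of the difference of the two sides is (1 - 2y) g + 2y (1 - y)
    g' - 1, which is 0 by the differential equation. *)
Lemma sin_cos_PSeries_arcsin_coef (t : R) : 0 <= t < PI / 2 ->
  sin t * cos t * PSeries arcsin_coef (sin t ^ 2) = t.
Proof.
  intros Ht.
  assert (E : sin t * cos t * PSeries arcsin_coef (sin t ^ 2) - t
              = sin 0 * cos 0 * PSeries arcsin_coef (sin 0 ^ 2) - 0).
  { apply (const_of_zero_derive (fun t => sin t * cos t * PSeries arcsin_coef (sin t ^ 2) - t)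
      (fun t => (cos t * cos t - sin t * sin t) * PSeries arcsin_coef (sin t ^ 2)
         + sin t * cos t * ((2 * sin t * cos t) * PSeries (PS_derive arcsin_coef) (sin t ^ 2))
         - 1));
      [ lra | | ].
    - intros x Hx. destruct (sin_sqr_lt_1 x) as [Hc Hs]; [ lra | ].
      apply (is_derive_minus (V := R_NormedModule)
               (fun t => sin t * cos t * PSeries arcsin_coef (sin t ^ 2)) (fun t => t));
        [ | apply (is_derive_id (K := R_AbsRing)) ].
      apply (is_derive_mult (K := R_AbsRing) (fun t => sin t * cos t)
               (fun t => PSeries arcsin_coef (sin t ^ 2))).
      + auto_derive; [ auto | ring ].
      + apply (is_derive_comp (V := R_NormedModule) (PSeries arcsin_coef) (fun t => sin t ^ 2)).
        * apply is_derive_PSeries, CV_radius_bounded_by_1; [ apply arcsin_coef_bound | exact Hs ].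
        * auto_derive; [ auto | ring ].
      + intros; apply Rmult_comm.
    - intros x Hx. destruct (sin_sqr_lt_1 x) as [Hc Hs]; [ lra | ].
      rewrite <- (PSeries_arcsin_coef_ode _ Hs).
      assert (E := sin2_cos2 x). unfold Rsqr in E.
      replace (1 - sin x ^ 2) with (cos x * cos x) by (rewrite <- E; ring).
      replace (1 - 2 * sin x ^ 2) with (cos x * cos x - sin x * sin x)
        by (rewrite <- E; ring). ring. }
  rewrite sin_0 in E. lra.
Qed.

(** * Dirichlet series *)

Lemma CSeries_unique (a : nat -> C) (l : C) :
  is_series (K := C_AbsRing) (V := C_NormedModule) a l -> CSeries a = l.
Proof.
  intros H. unfold CSeries, is_series.
  exact (iota_filterlim_locally (V := C_CompleteNormedModule) _ _ H).
Qed.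

Lemma CSeries_correct (a : nat -> C) (b : nat -> R) :
  (forall k, Cmod (a k) <= b k) -> ex_series b ->
  is_series (K := C_AbsRing) (V := C_NormedModule) a (CSeries a).
Proof.
  intros Hab Hb.
  destruct (ex_series_le (K := C_AbsRing) (V := C_CompleteNormedModule) a b) as [l Hl].
  - intros n. exact (Hab n).
  - exact Hb.
  - now rewrite (CSeries_unique _ _ Hl).
Qed.

Lemma Cmod_series_le (a : nat -> C) (b : nat -> R) (l : C) (B : R) :
  (forall k, Cmod (a k) <= b k) ->
  is_series (K := C_AbsRing) (V := C_NormedModule) a l -> is_series b B -> Cmod l <= B.
Proof.
  intros Hab Ha Hb.
  assert (H : forall n, Cmod (sum_n (G := C_AbelianMonoid) a n) <= sum_n b n).
  { induction n as [|n IH].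
    - rewrite !sum_O. apply Hab.
    - rewrite !sum_Sn. eapply Rle_trans; [ apply Cmod_triangle | ].
      apply Rplus_le_compat; [ exact IH | apply Hab ]. }
  apply (filterlim_le (F := eventually)
    (fun n => Cmod (sum_n (G := C_AbelianMonoid) a n)) (sum_n b) (Cmod l) B).
  - apply filter_forall. exact H.
  - apply (filterlim_comp _ _ _ _ _ _ _ _ Ha).
    apply (filterlim_norm (V := C_NormedModule)).
  - exact Hb.
Qed.

(** * Second-order bounds for the complex exponential *)

Lemma exp_sub_1_bound (x : R) : Rabs (exp x - 1) <= Rabs x * exp (Rabs x).
Proof.
  assert (H1 := exp_ineq1_le x). assert (H2 := exp_ineq1_le (- x)).
  assert (P := exp_pos x).
  assert (E : exp x * exp (- x) = 1) by (rewrite <- exp_plus, Rplus_opp_r; apply exp_0).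
  unfold Rabs at 2 3. destruct (Rcase_abs x) as [Hx|Hx].
  - rewrite Rabs_left1 by nra. assert (Q := exp_ineq1_le (- x)). nra.
  - rewrite Rabs_pos_eq by lra. nra.
Qed.

Lemma exp_taylor_bound (x : R) : Rabs (exp x - 1 - x) <= x ^ 2 * exp (Rabs x).
Proof.
  assert (H1 := exp_ineq1_le x). rewrite Rabs_pos_eq by lra.
  assert (H2 := exp_ineq1_le (- x)). assert (P := exp_pos x).
  assert (E : exp x * exp (- x) = 1) by (rewrite <- exp_plus, Rplus_opp_r; apply exp_0).
  assert (H3 : exp x - 1 - x <= x * (exp x - 1)) by nra.
  eapply Rle_trans; [ exact H3 | ]. eapply Rle_trans; [ apply Rle_abs | ].
  rewrite Rabs_mult.
  replace (x ^ 2 * exp (Rabs x)) with (Rabs x * (Rabs x * exp (Rabs x))).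
  - apply Rmult_le_compat_l; [ apply Rabs_pos | apply exp_sub_1_bound ].
  - rewrite <- (pow2_abs x). ring.
Qed.

Lemma sin_taylor_bound (y : R) : Rabs (sin y - y) <= y ^ 2.
Proof.
  destruct (MVT_gen (fun y => sin y - y) 0 y (fun y => cos y - 1)) as [c [Hc E]].
  - intros x _. auto_derive; [ auto | ring ].
  - intros x _. apply continuity_pt_filterlim.
    apply (ex_derive_continuous (V := R_NormedModule) (fun y => sin y - y)). auto_derive; auto.
  - rewrite sin_0 in E. replace (sin y - y) with ((cos c - 1) * y) by lra.
    rewrite Rabs_mult, <- (pow2_abs y).
    assert (Hcy : Rabs c <= Rabs y).
    { revert Hc. unfold Rmin, Rmax, Rabs.
      destruct (Rle_dec 0 y), (Rcase_abs c), (Rcase_abs y); lra. }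
    assert (H1 := one_minus_sqr_le_cos c). destruct (COS_bound c) as [H2 H3].
    (* The distance is at most c^2/2 and at most 2; the first bound serves for |c| <= 2, the second
       beyond. *)
    assert (H4 : Rabs (cos c - 1) <= Rabs c).
    { rewrite Rabs_left1 by lra. rewrite <- (pow2_abs c) in H1.
      generalize (Rabs_pos c). nra. }
    generalize (Rabs_pos y). nra.
Qed.

Lemma Cmod_le_sum (z : C) : Cmod z <= Rabs (Re z) + Rabs (Im z).
Proof.
  replace z with (RtoC (Re z) + Ci * RtoC (Im z))%C at 1
    by (apply C_eq; unfold Re, Im; simpl; ring).
  eapply Rle_trans; [ apply Cmod_triangle | ].
  rewrite Cmod_mult, !Cmod_R.
  replace (Cmod Ci) with 1; [ lra | ].
  transitivity (sqrt 1); [ symmetry; apply sqrt_1 | ]. unfold Cmod; simpl. f_equal. ring.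
Qed.

(** With v = x + iy, the remainder splits into e^x (e^(iy) - 1 - iy), the real remainder of e^x, and
    (e^x - 1) iy. They are bounded by 2 y^2, x^2 and |x| |y|, each times e^|v|; the cross term is
    absorbed by 2 |x| |y| <= x^2 + y^2, and 3 covers the total. *)
Lemma Cexp_taylor_bound (v : C) : Cmod (Cexp v - 1 - v) <= 3 * Cmod v ^ 2 * exp (Cmod v).
Proof.
  set (x := Re v). set (y := Im v).
  assert (Hx : Rabs x <= Cmod v) by apply re_le_Cmod.
  assert (Hy : Rabs y <= Cmod v) by apply Im_le_Cmod.
  assert (E1 : exp x <= exp (Cmod v)) by (apply exp_le; generalize (Rle_abs x); lra).
  assert (E2 : exp (Rabs x) <= exp (Cmod v)) by (now apply exp_le).
  assert (P := exp_pos x). assert (P2 := exp_pos (Rabs x)).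
  assert (M2 : Cmod v ^ 2 = x ^ 2 + y ^ 2) by (apply Cmod2_alt).
  replace (Cexp v - 1 - v)%C with
    (RtoC (exp x) * ((cos y - 1)%R, (sin y - y)%R)
     + (RtoC (exp x - 1 - x) + RtoC (exp x - 1) * (0, y)))%C.
  2:{ apply C_eq; unfold Cexp; fold x y; unfold Re, Im; simpl.
      - change (fst v) with x. ring.
      - change (snd v) with y. ring. }
  eapply Rle_trans; [ apply Cmod_triangle | ].
  assert (B1 : Cmod (RtoC (exp x) * ((cos y - 1)%R, (sin y - y)%R)) <= exp (Cmod v) * (2 * y ^ 2)).
  { rewrite Cmod_mult, Cmod_R, Rabs_pos_eq by lra.
    apply Rmult_le_compat; [ lra | apply Cmod_ge_0 | exact E1 | ].
    eapply Rle_trans; [ apply Cmod_le_sum | ]. simpl Re; simpl Im.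
    assert (S := sin_taylor_bound y). assert (H1 := one_minus_sqr_le_cos y).
    destruct (COS_bound y) as [_ H3]. rewrite (Rabs_left1 (cos y - 1)) by lra.
    generalize (pow2_ge_0 y). lra. }
  assert (B2 : Cmod (RtoC (exp x - 1 - x) + RtoC (exp x - 1) * (0, y))
               <= exp (Cmod v) * (x ^ 2 + Rabs x * Rabs y)).
  { eapply Rle_trans; [ apply Cmod_triangle | ]. rewrite Cmod_mult, !Cmod_R.
    replace (Cmod (0, y)) with (Rabs y).
    2:{ unfold Cmod; simpl. rewrite <- sqrt_Rsqr_abs. f_equal. unfold Rsqr. ring. }
    assert (T1 := exp_taylor_bound x). assert (T2 := exp_sub_1_bound x).
    assert (Q1 := pow2_ge_0 x). assert (Q2 := Rabs_pos x). assert (Q3 := Rabs_pos y).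
    assert (x ^ 2 * exp (Rabs x) <= x ^ 2 * exp (Cmod v)) by (now apply Rmult_le_compat_l).
    assert (Rabs (exp x - 1) * Rabs y <= Rabs x * exp (Cmod v) * Rabs y).
    { apply Rmult_le_compat_r; [ exact Q3 | ]. eapply Rle_trans; [ exact T2 | ].
      now apply Rmult_le_compat_l. }
    lra. }
  assert (H : 2 * Rabs x * Rabs y <= x ^ 2 + y ^ 2).
  { rewrite <- (pow2_abs x), <- (pow2_abs y).
    generalize (pow2_ge_0 (Rabs x - Rabs y)). lra. }
  rewrite M2. assert (PM := exp_pos (Cmod v)).
  assert (Qx := pow2_ge_0 x). assert (Qy := pow2_ge_0 y).
  replace (3 * (x ^ 2 + y ^ 2) * exp (Cmod v)) with (exp (Cmod v) * (3 * (x ^ 2 + y ^ 2))) by ring.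
  eapply Rle_trans; [ apply Rplus_le_compat; [ exact B1 | exact B2 ] | ].
  rewrite <- Rmult_plus_distr_l. apply Rmult_le_compat_l; lra.
Qed.

(** * Entire Dirichlet series *)

Definition dirichlet (c lam : nat -> R) (s : C) : C :=
  CSeries (fun k => RtoC (c k) * Rcpow (lam k) (1 - s))%C.

(** The absolute value of the logarithm controls powers of [lam k] of either sign, and since p is
    arbitrary the series converges absolutely for every s, with room for the extra logarithms of its
    derivatives. *)
Definition dirichlet_summable (c lam : nat -> R) : Prop :=
  (forall k, 0 <= c k) /\
  forall p, 0 <= p -> ex_series (fun k => c k * exp (p * Rabs (ln (lam k)))).

Lemma exp_mult_le_abs (p q : R) : exp (p * q) <= exp (Rabs p * Rabs q).
Proof. apply exp_le. rewrite <- Rabs_mult. apply Rle_abs. Qed.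

Lemma dirichlet_correct (c lam : nat -> R) (s : C) : dirichlet_summable c lam ->
  is_series (K := C_AbsRing) (V := C_NormedModule)
    (fun k => RtoC (c k) * Rcpow (lam k) (1 - s))%C (dirichlet c lam s).
Proof.
  intros [Hc Hs].
  apply (CSeries_correct _ (fun k => c k * exp (Rabs (Re (1 - s)) * Rabs (ln (lam k))))).
  - intros k. rewrite Cmod_mult, Cmod_R, Rabs_pos_eq, Cmod_Rcpow by apply Hc.
    apply Rmult_le_compat_l; [ apply Hc | apply exp_mult_le_abs ].
  - apply Hs. apply Rabs_pos.
Qed.

Lemma sqr_le_exp (t : R) : 0 <= t -> t ^ 2 <= 4 * exp t.
Proof.
  intros Ht. assert (H := exp_ineq1_le (t / 2)).
  replace (exp t) with (exp (t / 2) * exp (t / 2))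
    by (rewrite <- exp_plus; f_equal; field).
  nra.
Qed.

(** Differentiability follows from a quadratic bound on the remainder near s, obtained termwise from
    [Cexp_taylor_bound] and summed. *)
Lemma dirichlet_ex_derive (c lam : nat -> R) (s : C) : dirichlet_summable c lam ->
  @ex_derive C_AbsRing C_NormedModule (dirichlet c lam) s.
Proof.
  intros Hsum. assert (Hcs := Hsum). destruct Hsum as [Hc Hs].
  set (p0 := Rabs (Re (1 - s))). assert (Hp0 : 0 <= p0) by apply Rabs_pos.
  set (mu := fun k => ln (lam k)).
  set (dt := fun k => (RtoC (c k) * (RtoC (- mu k) * Rcpow (lam k) (1 - s)))%C).
  assert (Hdt : is_series (K := C_AbsRing) (V := C_NormedModule) dt (CSeries dt)).
  { apply (CSeries_correct _ (fun k => c k * exp ((p0 + 1) * Rabs (ln (lam k))))).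
    - intros k. unfold dt.
      rewrite !Cmod_mult, !Cmod_R, Rabs_pos_eq, Cmod_Rcpow, Rabs_Ropp by apply Hc.
      apply Rmult_le_compat_l; [ apply Hc | ].
      rewrite Rmult_plus_distr_r, exp_plus, Rmult_1_l, Rmult_comm.
      assert (H1 := exp_ineq1_le (Rabs (mu k))).
      apply Rmult_le_compat; [ left; apply exp_pos | apply Rabs_pos | apply exp_mult_le_abs | ].
      unfold mu in *. lra.
    - apply Hs. lra. }
  destruct (Hs (p0 + 2) ltac:(lra)) as [B0 HB0].
  (* With m = |ln (lam k)| and |w| <= 1, the termwise remainder is at most 3 |w|^2 m^2 e^m, and m^2
     <= 4 e^m. This explains both 12 and the extra 2 in [p0 + 2]. *)
  assert (HB := is_series_scal (V := R_NormedModule) 12 _ _ HB0).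
  set (B := scal 12 B0) in HB.
  set (b := fun k => scal 12 (c k * exp ((p0 + 2) * Rabs (ln (lam k))))) in HB.
  assert (Hquad : forall y : C, Cmod (y - s) <= 1 ->
     Cmod (dirichlet c lam y - dirichlet c lam s - (y - s) * CSeries dt) <= B * Cmod (y - s) ^ 2).
  { intros y Hy. set (w := (y - s)%C) in *.
    assert (Hser := is_series_minus (K := C_AbsRing) (V := C_NormedModule) _ _ _ _
       (is_series_minus (K := C_AbsRing) (V := C_NormedModule) _ _ _ _
          (dirichlet_correct c lam y Hcs) (dirichlet_correct c lam s Hcs))
       (is_series_scal (K := C_AbsRing) (V := C_NormedModule) w _ _ Hdt)).
    refine (Cmod_series_le _ (fun k => scal (Cmod w ^ 2) (b k)) _ _ _ Hser _).
    2:{ replace (B * Cmod w ^ 2) with (scal (Cmod w ^ 2) B) by apply Rmult_comm.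
        apply (is_series_scal (V := R_NormedModule)), HB. }
    intros k.
    match goal with |- Cmod ?X <= _ =>
      replace X with (RtoC (c k) * (Rcpow (lam k) (1 - s)
        * (Cexp (- w * RtoC (mu k)) - 1 - (- w * RtoC (mu k)))))%C end.
    2:{ assert (Ey : Rcpow (lam k) (1 - y) = (Rcpow (lam k) (1 - s) * Cexp (- w * RtoC (mu k)))%C).
        { change (Cexp (- w * RtoC (mu k))) with (Rcpow (lam k) (- w)).
          rewrite <- Rcpow_plus. f_equal. unfold w. ring. }
        unfold minus, plus, opp, scal; simpl. unfold mult; simpl.
        rewrite Ey. unfold dt. rewrite RtoC_opp. ring. }
    rewrite !Cmod_mult, Cmod_R, Rabs_pos_eq, Cmod_Rcpow by apply Hc.
    assert (Ht := Cexp_taylor_bound (- w * RtoC (mu k))).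
    rewrite Cmod_mult, Cmod_opp, Cmod_R in Ht.
    set (m := Rabs (mu k)) in *. assert (Hm : 0 <= m) by apply Rabs_pos.
    assert (Hw := Cmod_ge_0 w).
    assert (Hq := sqr_le_exp m Hm).
    assert (He : exp (Cmod w * m) <= exp m) by (apply exp_le; nra).
    assert (Hr : exp (Re (1 - s) * ln (lam k)) <= exp (p0 * m)) by apply exp_mult_le_abs.
    assert (Hfin : 3 * (Cmod w * m) ^ 2 * exp (Cmod w * m)
                   <= Cmod w ^ 2 * 12 * (exp m * exp m)).
    { replace (3 * (Cmod w * m) ^ 2 * exp (Cmod w * m))
        with (Cmod w ^ 2 * 3 * (m ^ 2 * exp (Cmod w * m))) by ring.
      replace (Cmod w ^ 2 * 12 * (exp m * exp m))
        with (Cmod w ^ 2 * 3 * (4 * exp m * exp m)) by ring.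
      apply Rmult_le_compat_l; [ generalize (pow2_ge_0 (Cmod w)); lra | ].
      apply Rmult_le_compat; [ apply pow2_ge_0 | left; apply exp_pos | exact Hq | exact He ]. }
    unfold b, scal; simpl; unfold mult; simpl.
    replace (Cmod w * (Cmod w * 1) * (12 * (c k * exp ((p0 + 2) * Rabs (ln (lam k))))))
      with (c k * (exp (p0 * m) * (Cmod w ^ 2 * 12 * (exp m * exp m)))).
    2:{ replace ((p0 + 2) * Rabs (ln (lam k))) with (p0 * m + (m + m))
          by (unfold m, mu; ring). rewrite !exp_plus. ring. }
    apply Rmult_le_compat_l; [ apply Hc | ].
    apply Rmult_le_compat; [ left; apply exp_pos | apply Cmod_ge_0 | exact Hr | lra ]. }
  assert (HB0' : 0 <= B).
  { assert (Hz := Hquad (s + 1)%C). replace (s + 1 - s)%C with (RtoC 1) in Hz by ring.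
    rewrite Cmod_1 in Hz.
    eapply Rle_trans; [ apply Cmod_ge_0 | ]. eapply Rle_trans; [ apply Hz; lra | ]. lra. }
  exists (CSeries dt). split.
  - apply (is_linear_scal_l (K := C_AbsRing) (V := C_NormedModule)).
  - intros x Hx.
    assert (Ex : s = x)
      by (apply (is_filter_lim_locally_unique (V := AbsRing_NormedModule C_AbsRing)); exact Hx).
    subst x. intros eps.
    assert (Hd : 0 < Rmin 1 (eps / (B + 1))).
    { apply Rmin_pos; [ lra | apply Rdiv_lt_0_compat; [ apply cond_pos | lra ] ]. }
    exists (mkposreal _ Hd). intros y Hy.
    assert (Hy' : Cmod (y - s) < Rmin 1 (eps / (B + 1))) by exact Hy.
    assert (M1 := Rmin_l 1 (eps / (B + 1))). assert (M2 := Rmin_r 1 (eps / (B + 1))).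
    eapply Rle_trans; [ apply (Hquad y); lra | ].
    change (norm (minus y s)) with (Cmod (y - s)).
    assert (H1 : Cmod (y - s) < eps / (B + 1)) by lra.
    apply Rlt_div_r in H1; [ | lra ].
    generalize (Cmod_ge_0 (y - s)). intros H0. simpl. nra.
Qed.

(** Here |ln (lam k)| <= ln (2 (k+1)), so the weight is at most the power (2 (k+1))^p, which costs
    only half of the geometric decay. *)
Lemma dirichlet_summable_geometric (c lam : nat -> R) (M q : R) :
  0 < q < 1 -> (forall k, 0 <= c k <= M * q ^ k) ->
  (forall k, 1 / 2 <= lam k <= INR k + 1) -> dirichlet_summable c lam.
Proof.
  intros Hq Hc Hl. split; [ intros k; apply Hc | ]. intros p Hp.
  assert (HM : 0 <= M) by (generalize (Hc 0%nat); simpl; lra).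
  assert (Hln : ln q < 0) by (rewrite <- ln_1; apply ln_increasing; lra).
  (* At 2 (k+1) the rate -ln q / 4 amounts to q^(-(k+1)/2); the product with q^k is r^k / r for r =
     sqrt q. *)
  destruct (rpow_le_exp p (- ln q / 4) Hp) as [K [HK Hexp]]; [ lra | ].
  set (r := exp (ln q / 2)).
  assert (Hr : 0 < r < 1).
  { split; [ apply exp_pos | ]. unfold r. rewrite <- exp_0. apply exp_increasing. lra. }
  apply (ex_series_le (V := R_CompleteNormedModule) _ (fun k => scal (M * (K * / r)) (r ^ k))).
  2:{ apply (ex_series_scal (V := R_NormedModule)). apply ex_series_geom.
      rewrite Rabs_pos_eq; lra. }
  intros k. assert (Pk := pos_INR k). destruct (Hl k) as [L1 L2].
  change norm with Rabs.
  rewrite Rabs_pos_eq by (apply Rmult_le_pos; [ apply Hc | left; apply exp_pos ]).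
  assert (H2k : 0 < 2 * (INR k + 1)) by lra.
  assert (Hab : Rabs (ln (lam k)) <= ln (2 * (INR k + 1))).
  { apply Rabs_le. rewrite <- ln_Rinv by exact H2k. split.
    - destruct (Rle_lt_or_eq_dec (/ (2 * (INR k + 1))) (lam k)) as [H|H].
      + apply Rle_trans with (1 / 2); [ | lra ].
        apply Rmult_le_reg_l with (2 * (INR k + 1)); [ lra | ]. rewrite Rinv_r by lra. lra.
      + left. apply ln_increasing; [ now apply Rinv_0_lt_compat | exact H ].
      + rewrite <- H. lra.
    - left. apply ln_increasing; lra. }
  assert (Hqk : q ^ k = exp (INR k * ln q)).
  { rewrite <- Rpower_pow by lra. reflexivity. }
  assert (Hrk : r ^ k = exp (INR k * (ln q / 2))).
  { unfold r. rewrite <- Rpower_pow by apply exp_pos. unfold Rpower. now rewrite ln_exp. }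
  apply Rle_trans with (M * q ^ k * (K * exp (- ln q / 4 * (2 * (INR k + 1))))).
  - apply Rmult_le_compat; [ apply Hc | left; apply exp_pos | apply Hc | ].
    eapply Rle_trans; [ | apply (Hexp _ H2k) ].
    apply exp_le. now apply Rmult_le_compat_l.
  - right. unfold scal; simpl; unfold mult; simpl. rewrite Hqk, Hrk.
    unfold r. rewrite <- exp_Ropp.
    replace (M * (K * exp (- (ln q / 2))) * exp (INR k * (ln q / 2)))
      with (M * K * (exp (- (ln q / 2)) * exp (INR k * (ln q / 2)))) by ring.
    replace (M * exp (INR k * ln q) * (K * exp (- ln q / 4 * (2 * (INR k + 1)))))
      with (M * K * (exp (INR k * ln q) * exp (- ln q / 4 * (2 * (INR k + 1))))) by ring.
    rewrite <- !exp_plus. f_equal. f_equal. field.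
Qed.

(** * Mellin transforms of series of exponentials *)

Lemma series_tail_bound (p q : nat -> R) (n : nat) :
  (forall k, 0 <= p k <= q k) -> ex_series q ->
  Rabs (Series p - sum_n p n) <= Series q - sum_n q n.
Proof.
  intros Hpq Hq.
  assert (Hp : ex_series p).
  { apply (ex_series_le (V := R_CompleteNormedModule) p q); [ | exact Hq ].
    intros k. change norm with Rabs. rewrite Rabs_pos_eq; apply Hpq. }
  rewrite (Series_incr_n p (S n)), (Series_incr_n q (S n)) by (auto; lia).
  rewrite !sum_n_Reals. simpl pred.
  assert (Hq' : ex_series (fun k => q (S n + k)%nat)) by now apply (ex_series_incr_n q (S n)).
  assert (H0 : 0 <= Series (fun k => p (S n + k)%nat)).
  { rewrite <- (Rmult_0_l (Series p)), <- Series_scal_l.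
    apply Series_le; [ | now apply (ex_series_incr_n p (S n)) ].
    intros k. rewrite Rmult_0_l. split; [ lra | apply Hpq ]. }
  assert (H1 : Series (fun k => p (S n + k)%nat) <= Series (fun k => q (S n + k)%nat)).
  { apply Series_le; [ intros k; apply Hpq | exact Hq' ]. }
  rewrite Rabs_pos_eq; lra.
Qed.

Lemma is_RInt_gen_exp_sum (a : C) (c lam : nat -> R) (n : nat) : 0 < Re a ->
  (forall k, 0 < lam k) ->
  is_RInt_gen (V := C_R_NormedModule)
    (fun u => Rcpow u (a - 1) * RtoC (sum_n (fun k => c k * exp (- (lam k * u))) n)%R)%C
    (at_right 0) (Rbar_locally p_infty)
    (sum_n (G := C_AbelianMonoid) (fun k => CGamma a * (RtoC (c k) * Rcpow (lam k) (- a)))%C n).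
Proof.
  intros Ha Hl.
  assert (H1 : forall k, is_RInt_gen (V := C_R_NormedModule)
     (fun u => RtoC (c k) * (Rcpow u (a - 1) * RtoC (exp (- (lam k * u)))))%C
     (at_right 0) (Rbar_locally p_infty) (CGamma a * (RtoC (c k) * Rcpow (lam k) (- a)))%C).
  { intros k.
    replace (CGamma a * (RtoC (c k) * Rcpow (lam k) (- a)))%C
      with (RtoC (c k) * (CGamma a * Rcpow (lam k) (- a)))%C by ring.
    apply is_RInt_gen_Cmult. now apply is_RInt_gen_exp_scale. }
  induction n as [|n IH].
  - rewrite sum_O. generalize (H1 0%nat). apply is_RInt_gen_C_ext_pos. intros t Ht.
    rewrite sum_O, RtoC_mult. ring.
  - rewrite sum_Sn.
    apply is_RInt_gen_C_ext_pos with (fun u =>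
      Rcpow u (a - 1) * RtoC (sum_n (fun k => c k * exp (- (lam k * u))) n)%R
      + RtoC (c (S n)) * (Rcpow u (a - 1) * RtoC (exp (- (lam (S n) * u)))))%C.
    + intros t Ht. rewrite sum_Sn. change plus with Rplus. rewrite RtoC_plus, RtoC_mult. ring.
    + apply (is_RInt_gen_plus (V := C_R_NormedModule)); [ exact IH | apply H1 ].
Qed.

(* The frequencies are bounded below so that the tails of the series are dominated by a multiple
   of e^(-u/2), uniformly on (0, +oo). *)
Lemma is_RInt_gen_exp_series (s : C) (c lam : nat -> R) (H : R -> R) :
  1 < Re s -> dirichlet_summable c lam -> (forall k, 1 / 2 <= lam k) ->
  (forall u, 0 < u -> is_series (fun k => c k * exp (- (lam k * u))) (H u)) ->
  (forall u, 0 < u -> continuous H u) ->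
  is_RInt_gen (V := C_R_NormedModule) (fun u => Rcpow u (s - 2) * RtoC (H u))%C
    (at_right 0) (Rbar_locally p_infty) (CGamma (s - 1) * dirichlet c lam s)%C.
Proof.
  intros Hs Hsum Hl HH Hcont. assert (Hd := dirichlet_correct c lam s Hsum).
  destruct Hsum as [Hc Hsum].
  assert (Ha : 0 < Re (s - 1)) by (unfold Re in *; simpl; lra).
  assert (Hcs : ex_series c).
  { generalize (Hsum 0 (Rle_refl 0)). apply ex_series_ext. intros k.
    rewrite Rmult_0_l, exp_0. apply Rmult_1_r. }
  assert (Hhalf : 0 < 1 / 2) by lra.
  (* The dominating weight is u^(Re s - 2) e^(-u/2), itself a Mellin integrand with a real exponent
     and frequency 1/2; [delta n] will be the tail of the series of [c]. *)
  assert (Hg := is_RInt_gen_Re _ _ (is_RInt_gen_exp_scale (RtoC (Re (s - 1))) (1 / 2) Ha Hhalf)).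
  refine (is_RInt_gen_uniform_limit _ _ _ (fun n => Series c - sum_n c n) _ _ _
           (fun n => is_RInt_gen_exp_sum (s - 1)%C c lam n Ha
                       (fun k => Rlt_le_trans _ _ _ Hhalf (Hl k))) _ _ Hg _).
  - assert (Hd' := is_series_scal (K := C_AbsRing) (V := C_NormedModule) (CGamma (s - 1)) _ _ Hd).
    refine (is_series_ext (K := C_AbsRing) (V := C_NormedModule) _ _ _ _ Hd').
    intros k. replace (- (s - 1))%C with (1 - s)%C by ring. reflexivity.
  - replace (Finite 0) with (Finite (Series c - Series c)) by (f_equal; ring).
    apply (is_lim_seq_minus' (fun _ => Series c) (sum_n c));
      [ apply is_lim_seq_const | apply (Series_correct c Hcs) ].
  - generalize at_right_0_p_infty_pos. apply filter_imp. intros [u v]; simpl. intros Huv.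
    split; [ lra | split ].
    + apply ex_RInt_pos; [ | lra | lra ]. intros t Ht.
      apply continuous_Cmult; [ now apply continuous_Rcpow | now apply continuous_RtoC, Hcont ].
    + intros n x Hx. assert (Hx0 : 0 < x) by lra.
      replace (s - 1 - 1)%C with (s - 2)%C by ring.
      replace (Rcpow x (s - 2) * RtoC (H x)
               - Rcpow x (s - 2) * RtoC (sum_n (fun k => c k * exp (- (lam k * x))) n)%R)%C
        with (Rcpow x (s - 2) * RtoC (H x - sum_n (fun k => c k * exp (- (lam k * x))) n)%R)%C
        by (rewrite RtoC_minus; ring).
      rewrite Cmod_mult, Cmod_Rcpow, Cmod_R.
      assert (E : Re (Rcpow x (RtoC (Re (s - 1)) - 1) * RtoC (exp (- (1 / 2 * x))))
                  = exp (Re (s - 2) * ln x) * exp (- (1 / 2 * x))).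
      { rewrite <- RtoC_minus, Rcpow_RtoC, <- RtoC_mult. simpl.
        f_equal. f_equal. f_equal. unfold Re; simpl. ring. }
      match goal with |- _ <= _ * ?r => replace r with
        (exp (Re (s - 2) * ln x) * exp (- (1 / 2 * x))) end.
      replace ((Series c - sum_n c n) * (exp (Re (s - 2) * ln x) * exp (- (1 / 2 * x))))
        with (exp (Re (s - 2) * ln x) * ((Series c - sum_n c n) * exp (- (1 / 2 * x)))) by ring.
      apply Rmult_le_compat_l; [ left; apply exp_pos | ].
      rewrite <- (is_series_unique _ _ (HH x Hx0)).
      (* Because [lam k >= 1/2] and [x > 0], the terms c_k e^(-x/2) majorize those of the series,
         and the tail inherits the bound. *)
      set (q := fun k => scal (exp (- (1 / 2 * x))) (c k)).
      assert (Hq : is_series q (scal (exp (- (1 / 2 * x))) (Series c))).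
      { apply (is_series_scal (V := R_NormedModule)). now apply Series_correct. }
      eapply Rle_trans; [ apply (series_tail_bound _ q) | ].
      * intros k. unfold q, scal; simpl; unfold mult; simpl. split.
        -- apply Rmult_le_pos; [ apply Hc | left; apply exp_pos ].
        -- rewrite Rmult_comm. apply Rmult_le_compat_r; [ apply Hc | ].
           apply exp_le. specialize (Hl k). nra.
      * eexists; exact Hq.
      * right. rewrite (is_series_unique _ _ Hq). unfold q.
        rewrite (sum_n_scal_l (V := R_ModuleSpace)). unfold scal; simpl; unfold mult; simpl.
        rewrite Rmult_minus_distr_r. f_equal; apply Rmult_comm.
Qed.

(** * The central binomial series and the sine integral *)

(** These are what remains of the terms of [zetaCB] and [etaCB] once lambda^(1-s) is split off, with
    lambda = m in the first and lambda = m + 1/2 in the second. A factor PI is also taken out of the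
    second. *)
Definition zeta_coef (z : R) (k : nat) : R := 2 * arcsin_coef k * (z ^ 2) ^ S k.
Definition zeta_freq (k : nat) : R := INR (S k).
Definition eta_coef (z : R) (k : nat) : R := z * invsqrt_coef k * (z ^ 2) ^ k.
Definition eta_freq (k : nat) : R := INR k + 1 / 2.

Lemma zeta_summable (z : R) : 0 < z < 1 -> dirichlet_summable (zeta_coef z) zeta_freq.
Proof.
  intros Hz. assert (Hq : 0 < z ^ 2 < 1) by (simpl; nra).
  apply (dirichlet_summable_geometric _ _ 2 (z ^ 2) Hq).
  - intros k. unfold zeta_coef. assert (D := arcsin_coef_bound k).
    assert (P : 0 < (z ^ 2) ^ k) by (apply pow_lt; lra).
    change ((z ^ 2) ^ S k) with (z ^ 2 * (z ^ 2) ^ k).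
    split.
    + apply Rmult_le_pos; [ lra | apply Rmult_le_pos; lra ].
    + rewrite Rmult_assoc. apply Rmult_le_compat_l; [ lra | ]. rewrite <- Rmult_assoc.
      rewrite <- (Rmult_1_l ((z ^ 2) ^ k)) at 2. apply Rmult_le_compat_r; nra.
  - intros k. unfold zeta_freq. rewrite S_INR. generalize (pos_INR k). lra.
Qed.

Lemma eta_summable (z : R) : 0 < z < 1 -> dirichlet_summable (eta_coef z) eta_freq.
Proof.
  intros Hz. assert (Hq : 0 < z ^ 2 < 1) by (simpl; nra).
  apply (dirichlet_summable_geometric _ _ 1 (z ^ 2) Hq).
  - intros k. unfold eta_coef. assert (F := invsqrt_coef_bound k).
    assert (P : 0 < (z ^ 2) ^ k) by (apply pow_lt; lra).
    split.
    + apply Rmult_le_pos; nra.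
    + apply Rmult_le_compat_r; nra.
  - intros k. unfold eta_freq. generalize (pos_INR k). lra.
Qed.

Lemma Rcpow_1_minus (x : R) (s : C) : 0 < x -> Rcpow x (1 - s) = (RtoC x / Rcpow x s)%C.
Proof.
  intros Hx. unfold Cminus. rewrite Rcpow_plus, Rcpow_1, Rcpow_opp_inv by exact Hx. reflexivity.
Qed.

Lemma RtoC_neq_0 (x : R) : x <> 0 -> RtoC x <> 0%C.
Proof. intros H E. apply H. now apply RtoC_inj in E. Qed.

Lemma zetaCB_dirichlet (s : C) (z : R) : 0 < z < 1 ->
  zetaCB s (RtoC z) = dirichlet (zeta_coef z) zeta_freq s.
Proof.
  intros Hz. unfold zetaCB. apply CSeries_unique.
  refine (is_series_ext (K := C_AbsRing) (V := C_NormedModule) _ _ _ _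
            (dirichlet_correct _ _ s (zeta_summable z Hz))).
  intros k. cbv zeta. unfold zeta_freq, zeta_coef.
  assert (D := arcsin_coef_bound k). assert (Pk := pos_INR k).
  rewrite Rcpow_1_minus by (rewrite S_INR; lra).
  assert (E : ((2 * RtoC z) ^ (2 * S k))%C = RtoC ((2 * z) ^ (2 * S k))).
  { rewrite RtoC_pow, RtoC_mult. reflexivity. }
  assert (Hp : (2 * z) ^ (2 * S k) = 4 ^ S k * (z ^ 2) ^ S k).
  { rewrite pow_mult, <- Rpow_mult_distr. f_equal. ring. }
  rewrite E, central_binom_eq, Hp, S_INR.
  assert (P4 : 0 < 4 ^ S k) by (apply pow_lt; lra).
  set (p4 := 4 ^ S k) in *. set (pz := (z ^ 2) ^ S k).
  assert (HP := Rcpow_neq_0 (INR k + 1) s). set (P := Rcpow (INR k + 1) s) in *.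
  rewrite RtoC_div, !RtoC_mult by nra.
  change (@eq C (RtoC 2 * RtoC (arcsin_coef k) * RtoC pz * (RtoC (INR k + 1) / P))%C
    (RtoC p4 * RtoC pz / (RtoC p4 / (RtoC 2 * RtoC (INR k + 1) * RtoC (arcsin_coef k)) * P))%C).
  field. repeat split; try exact HP; apply RtoC_neq_0; lra.
Qed.

Lemma etaCB_dirichlet (s : C) (z : R) : 0 < z < 1 ->
  etaCB s (RtoC z) = (RtoC PI * dirichlet (eta_coef z) eta_freq s)%C.
Proof.
  intros Hz. unfold etaCB. apply CSeries_unique.
  refine (is_series_ext (K := C_AbsRing) (V := C_NormedModule) _ _ _ _
            (is_series_scal (K := C_AbsRing) (V := C_NormedModule) (RtoC PI) _ _
               (dirichlet_correct _ _ s (eta_summable z Hz)))).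
  intros k. unfold eta_freq, eta_coef.
  assert (F := invsqrt_coef_bound k). assert (Pk := pos_INR k). assert (HPI := PI_RGT_0).
  rewrite Rcpow_1_minus by lra.
  assert (E : ((2 * RtoC z) ^ (2 * k + 1))%C = RtoC ((2 * z) ^ (2 * k + 1))).
  { rewrite RtoC_pow, RtoC_mult. reflexivity. }
  assert (Hp : (2 * z) ^ (2 * k + 1) = 2 ^ (2 * k + 1) * (z * (z ^ 2) ^ k)).
  { rewrite Rpow_mult_distr, (pow_add z), pow_mult. ring. }
  rewrite E, half_binom_eq, Hp.
  assert (P2 : 0 < 2 ^ (2 * k + 1)) by (apply pow_lt; lra).
  set (p2 := 2 ^ (2 * k + 1)) in *. set (pz := (z ^ 2) ^ k).
  assert (HP := Rcpow_neq_0 (INR k + 1 / 2) s). set (P := Rcpow (INR k + 1 / 2) s) in *.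
  assert (Hd : PI * invsqrt_coef k * (INR k + 1 / 2) <> 0).
  { apply Rgt_not_eq. apply Rmult_lt_0_compat; [ apply Rmult_lt_0_compat | ]; lra. }
  set (m := INR k + 1 / 2) in *.
  rewrite RtoC_div, !RtoC_mult by exact Hd.
  change (@eq C (RtoC PI * (RtoC z * RtoC (invsqrt_coef k) * RtoC pz * (RtoC m / P)))%C
    (RtoC p2 * (RtoC z * RtoC pz) / (RtoC p2 / (RtoC PI * RtoC (invsqrt_coef k) * RtoC m) * P))%C).
  assert (0 < m) by (unfold m; lra).
  field. repeat split; try exact HP; apply RtoC_neq_0; lra.
Qed.

Lemma exp_INR_mult (k : nat) (x : R) : exp (INR k * x) = exp x ^ k.
Proof. rewrite <- Rpower_pow by apply exp_pos. unfold Rpower. now rewrite ln_exp. Qed.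

(** If sin t = z e^(-u/2) with 0 <= t < PI/2, then [zeta_gen z u] is 2 t tan t and [eta_gen z u] is
    tan t. In power series form they expand directly into the exponentials e^(-lambda u). *)
Definition zeta_gen (z u : R) : R :=
  2 * (z ^ 2 * exp (- u)) * PSeries arcsin_coef (z ^ 2 * exp (- u)).
Definition eta_gen (z u : R) : R :=
  z * exp (- (u / 2)) * PSeries invsqrt_coef (z ^ 2 * exp (- u)).

Lemma gen_radius (z u : R) : 0 < z < 1 -> 0 < u -> Rabs (z ^ 2 * exp (- u)) < 1.
Proof.
  intros Hz Hu. assert (P := exp_pos (- u)).
  assert (exp (- u) < 1) by (rewrite <- exp_0; apply exp_increasing; lra).
  rewrite Rabs_pos_eq; simpl; nra.
Qed.

Lemma zeta_gen_series (z u : R) : 0 < z < 1 -> 0 < u ->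
  is_series (fun k => zeta_coef z k * exp (- (zeta_freq k * u))) (zeta_gen z u).
Proof.
  intros Hz Hu. unfold zeta_gen.
  assert (H := PSeries_correct _ _ (CV_radius_inside _ _
                 (CV_radius_bounded_by_1 arcsin_coef _ arcsin_coef_bound (gen_radius z u Hz Hu)))).
  apply (is_series_scal (V := R_NormedModule) (2 * (z ^ 2 * exp (- u)))) in H.
  revert H. apply is_series_ext. intros k.
  match goal with |- @eq _ ?x ?y => change (@eq R x y) end.
  transitivity (2 * (z ^ 2 * exp (- u)) * ((z ^ 2 * exp (- u)) ^ k * arcsin_coef k)).
  { rewrite <- pow_n_pow. reflexivity. }
  unfold zeta_coef, zeta_freq.
  replace (- (INR (S k) * u)) with (- u + INR k * - u) by (rewrite S_INR; ring).
  rewrite exp_plus, exp_INR_mult, Rpow_mult_distr.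
  change ((z ^ 2) ^ S k) with (z ^ 2 * (z ^ 2) ^ k). ring.
Qed.

Lemma eta_gen_series (z u : R) : 0 < z < 1 -> 0 < u ->
  is_series (fun k => eta_coef z k * exp (- (eta_freq k * u))) (eta_gen z u).
Proof.
  intros Hz Hu. unfold eta_gen.
  assert (H := PSeries_correct _ _ (CV_radius_inside _ _
                 (CV_radius_bounded_by_1 invsqrt_coef _ invsqrt_coef_bound
                    (gen_radius z u Hz Hu)))).
  apply (is_series_scal (V := R_NormedModule) (z * exp (- (u / 2)))) in H.
  revert H. apply is_series_ext. intros k.
  match goal with |- @eq _ ?x ?y => change (@eq R x y) end.
  transitivity (z * exp (- (u / 2)) * ((z ^ 2 * exp (- u)) ^ k * invsqrt_coef k)).
  { rewrite <- pow_n_pow. reflexivity. }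
  unfold eta_coef, eta_freq.
  replace (- ((INR k + 1 / 2) * u)) with (- (u / 2) + INR k * - u) by field.
  rewrite exp_plus, exp_INR_mult, Rpow_mult_distr. ring.
Qed.

Lemma continuous_zeta_gen (z u : R) : 0 < z < 1 -> 0 < u -> continuous (zeta_gen z) u.
Proof.
  intros Hz Hu. apply (ex_derive_continuous (V := R_NormedModule)). unfold zeta_gen.
  auto_derive.
  apply ex_derive_PSeries, CV_radius_bounded_by_1; [ apply arcsin_coef_bound | ].
  now apply (gen_radius z u).
Qed.

Lemma continuous_eta_gen (z u : R) : 0 < z < 1 -> 0 < u -> continuous (eta_gen z) u.
Proof.
  intros Hz Hu. apply (ex_derive_continuous (V := R_NormedModule)). unfold eta_gen.
  auto_derive.
  apply ex_derive_PSeries, CV_radius_bounded_by_1; [ apply invsqrt_coef_bound | ].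
  now apply (gen_radius z u).
Qed.

(** * The substitution in the sine integral *)

Definition log_sin_ratio (z theta : R) : R := - 2 * ln (sin (theta / 2) / z).

Lemma sin_half_bounds (sigma theta : R) : 0 < theta < sigma -> sigma < PI ->
  0 < sin (theta / 2) < sin (sigma / 2).
Proof.
  intros Ht Hs. split; [ apply sin_gt_0; lra | apply sin_increasing_1; lra ].
Qed.

Lemma log_sin_ratio_pos (sigma theta : R) : 0 < theta < sigma -> sigma < PI ->
  0 < log_sin_ratio (sin (sigma / 2)) theta.
Proof.
  intros Ht Hs. destruct (sin_half_bounds sigma theta Ht Hs) as [H1 H2].
  unfold log_sin_ratio.
  assert (ln (sin (theta / 2) / sin (sigma / 2)) < 0); [ | lra ].
  rewrite <- ln_1. apply ln_increasing; [ apply Rdiv_lt_0_compat; lra | ].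
  apply Rlt_div_l; lra.
Qed.

Lemma is_derive_log_sin_ratio (z theta : R) : 0 < z -> 0 < theta < PI ->
  is_derive (log_sin_ratio z) theta (- (cos (theta / 2) / sin (theta / 2))).
Proof.
  intros Hz Ht. assert (H : 0 < sin (theta / 2)) by (apply sin_gt_0; lra).
  unfold log_sin_ratio. auto_derive.
  - apply Rdiv_lt_0_compat; lra.
  - unfold Rdiv. field. lra.
Qed.

Lemma log_sin_ratio_at_0 (sigma : R) : 0 < sigma < PI ->
  filterlim (log_sin_ratio (sin (sigma / 2))) (at_right 0) (Rbar_locally p_infty).
Proof.
  intros Hs. assert (Hz : 0 < sin (sigma / 2)) by (apply sin_gt_0; lra).
  set (z := sin (sigma / 2)) in *.
  intros P [M HM]. unfold filtermap.
  assert (P1 : 0 < 2 * (z * exp (- (M / 2)))).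
  { assert (E := exp_pos (- (M / 2))). nra. }
  (* For t below the second bound, sin(t/2) < t/2 < z e^(-M/2), so the logarithm is below -M/2; the
     bound [sigma] keeps t in the range where the sine is positive. *)
  assert (Hm : 0 < Rmin sigma (2 * (z * exp (- (M / 2))))) by (apply Rmin_pos; lra).
  generalize (at_right_0_lt _ Hm). apply filter_imp. intros t [Ht Hlt]. apply HM.
  assert (M1 := Rmin_l sigma (2 * (z * exp (- (M / 2))))).
  assert (M2 := Rmin_r sigma (2 * (z * exp (- (M / 2))))).
  destruct (sin_half_bounds sigma t) as [S1 _]; [ lra | lra | ].
  assert (S2 : sin (t / 2) < t / 2) by (apply sin_lt_x; lra).
  unfold log_sin_ratio.
  assert (ln (sin (t / 2) / z) < - (M / 2)); [ | lra ].
  rewrite <- (ln_exp (- (M / 2))). apply ln_increasing; [ now apply Rdiv_lt_0_compat | ].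
  apply Rlt_div_l; lra.
Qed.

Lemma at_left_gt (a b : R) : a < b -> at_left b (fun t => a < t < b).
Proof.
  intros Hab. assert (Hd : 0 < b - a) by lra. exists (mkposreal _ Hd). intros y Hy Hlt.
  unfold ball in Hy; simpl in Hy; unfold AbsRing_ball, abs, minus, plus, opp in Hy; simpl in Hy.
  apply Rabs_def2 in Hy. lra.
Qed.

(** Continuity gives the limit 0 at [sigma]; positivity to the left of [sigma] refines it to a limit
    from the right. *)
Lemma log_sin_ratio_at_sigma (sigma : R) : 0 < sigma < PI ->
  filterlim (log_sin_ratio (sin (sigma / 2))) (at_left sigma) (at_right 0).
Proof.
  intros Hs. assert (Hz : 0 < sin (sigma / 2)) by (apply sin_gt_0; lra).
  intros P [eps HP]. unfold filtermap.
  assert (Hc : continuous (log_sin_ratio (sin (sigma / 2))) sigma).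
  { apply (ex_derive_continuous (V := R_NormedModule)). eexists.
    apply is_derive_log_sin_ratio; lra. }
  assert (H0 : log_sin_ratio (sin (sigma / 2)) sigma = 0).
  { unfold log_sin_ratio. rewrite Rdiv_diag by lra. rewrite ln_1. ring. }
  unfold continuous in Hc. rewrite H0 in Hc.
  assert (Hb := Hc (ball 0 eps) (locally_ball _ _)). unfold filtermap in Hb.
  apply (filter_le_within (fun t => t < sigma)) in Hb.
  generalize (filter_and _ _ Hb (at_left_gt 0 sigma (proj1 Hs))). apply filter_imp.
  intros t [Hbt Ht]. apply HP; [ exact Hbt | ]. apply log_sin_ratio_pos; lra.
Qed.

(** With t = theta/2 this reads -cot t (sigma tan t - 2 t tan t) = 2 t - sigma: the Jacobian of the
    substitution removes the tangents and leaves the linear weight of the integral. *)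
Lemma gen_at_log_sin_ratio (sigma theta : R) : 0 < theta < sigma -> sigma < PI ->
  let u := log_sin_ratio (sin (sigma / 2)) theta in
  - (cos (theta / 2) / sin (theta / 2)) *
    (sigma * eta_gen (sin (sigma / 2)) u - zeta_gen (sin (sigma / 2)) u) = theta - sigma.
Proof.
  intros Ht Hs u. destruct (sin_half_bounds sigma theta Ht Hs) as [H1 H2].
  set (z := sin (sigma / 2)) in *. set (t := theta / 2) in *.
  assert (Hc : 0 < cos t) by (apply cos_gt_0; unfold t; lra).
  assert (Eu2 : z * exp (- (u / 2)) = sin t).
  { unfold u, log_sin_ratio. fold t.
    replace (- (- 2 * ln (sin t / z) / 2)) with (ln (sin t / z)) by field.
    rewrite exp_ln by (apply Rdiv_lt_0_compat; lra). field. lra. }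
  assert (Eu : z ^ 2 * exp (- u) = sin t ^ 2).
  { rewrite <- Eu2. replace (- u) with (- (u / 2) + - (u / 2)) by field. rewrite exp_plus. ring. }
  unfold eta_gen, zeta_gen. rewrite Eu, Eu2.
  assert (F := cos_PSeries_invsqrt_coef t ltac:(unfold t; lra)).
  assert (G := sin_cos_PSeries_arcsin_coef t ltac:(unfold t; lra)).
  set (f := PSeries invsqrt_coef (sin t ^ 2)) in *. set (g := PSeries arcsin_coef (sin t ^ 2)) in *.
  transitivity (2 * (sin t * cos t * g) - sigma * (cos t * f)).
  - field. lra.
  - rewrite F, G. unfold t. field.
Qed.

Lemma SLs_eq_dirichlet (s : C) (sigma : R) : 0 < sigma < PI -> 1 < Re s ->
  SLs s sigma =
    (dirichlet (zeta_coef (sin (sigma / 2))) zeta_freq s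
     - RtoC sigma * dirichlet (eta_coef (sin (sigma / 2))) eta_freq s)%C.
Proof.
  intros Hsig Hs.
  assert (Hz : 0 < sin (sigma / 2) < 1).
  { split; [ apply sin_gt_0; lra | ].
    rewrite <- sin_PI2. apply sin_increasing_1; lra. }
  set (z := sin (sigma / 2)) in *.
  assert (Ha : 0 < Re (s - 1)) by (unfold Re in *; simpl; lra).
  assert (HE := is_RInt_gen_exp_series s _ _ (eta_gen z) Hs (eta_summable z Hz)
    ltac:(intros k; unfold eta_freq; generalize (pos_INR k); lra)
    (fun u => eta_gen_series z u Hz) (fun u => continuous_eta_gen z u Hz)).
  assert (HZ := is_RInt_gen_exp_series s _ _ (zeta_gen z) Hs (zeta_summable z Hz)
    ltac:(intros k; unfold zeta_freq; rewrite S_INR; generalize (pos_INR k); lra)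
    (fun u => zeta_gen_series z u Hz) (fun u => continuous_zeta_gen z u Hz)).
  set (DE := dirichlet (eta_coef z) eta_freq s) in *.
  set (DZ := dirichlet (zeta_coef z) zeta_freq s) in *.
  set (h := fun u => (Rcpow u (s - 2) * RtoC (sigma * eta_gen z u - zeta_gen z u))%C).
  assert (Hh : is_RInt_gen (V := C_R_NormedModule) h (at_right 0) (Rbar_locally p_infty)
                 (RtoC sigma * (CGamma (s - 1) * DE) - CGamma (s - 1) * DZ)%C).
  { apply is_RInt_gen_C_ext_pos with
      (fun u => RtoC sigma * (Rcpow u (s - 2) * RtoC (eta_gen z u))
                - Rcpow u (s - 2) * RtoC (zeta_gen z u))%C.
    - intros u Hu. unfold h. rewrite RtoC_minus, RtoC_mult. ring.
    - apply (is_RInt_gen_minus (V := C_R_NormedModule));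
        [ now apply is_RInt_gen_Cmult | exact HZ ]. }
  (* The substitution is decreasing: theta near 0 corresponds to u near infinity, and theta near
     [sigma] to u near 0. Exchanging the ends produces the minus sign. *)
  apply (is_RInt_gen_swap (V := C_R_NormedModule)) in Hh.
  assert (Hcov := is_RInt_gen_comp h (log_sin_ratio z)
    (fun theta => - (cos (theta / 2) / sin (theta / 2))) _ Hh
    (log_sin_ratio_at_0 sigma Hsig) (log_sin_ratio_at_sigma sigma Hsig)).
  assert (Hdom : filter_prod (at_right 0) (at_left sigma)
                   (fun ab => 0 < fst ab < snd ab /\ snd ab < sigma)).
  { exists (fun t => 0 < t < sigma / 2) (fun t => sigma / 2 < t < sigma).
    - apply at_right_0_lt. lra.
    - apply at_left_gt. lra.
    - intros x y; simpl; lra. }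
  assert (Hside : filter_prod (at_right 0) (at_left sigma) (fun ab => forall x,
     Rmin (fst ab) (snd ab) <= x <= Rmax (fst ab) (snd ab) ->
     continuous (U := C_UniformSpace) h (log_sin_ratio z x) /\
     is_derive (log_sin_ratio z) x (- (cos (x / 2) / sin (x / 2))) /\
     continuous (fun theta => - (cos (theta / 2) / sin (theta / 2))) x)).
  { revert Hdom. apply filter_imp. intros [a b]; simpl. intros Hab x Hx.
    rewrite Rmin_left, Rmax_right in Hx by lra.
    assert (Hu : 0 < log_sin_ratio z x) by (apply log_sin_ratio_pos; lra).
    split; [ | split ].
    - apply continuous_Cmult; [ now apply continuous_Rcpow | ]. apply continuous_RtoC.
      apply (continuous_minus (V := R_NormedModule) (fun u => sigma * eta_gen z u) (zeta_gen z)).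
      + apply (continuous_scal_r (V := R_NormedModule) sigma (eta_gen z)).
        now apply continuous_eta_gen.
      + now apply continuous_zeta_gen.
    - apply is_derive_log_sin_ratio; lra.
    - apply (ex_derive_continuous (V := R_NormedModule)
               (fun theta => - (cos (theta / 2) / sin (theta / 2)))). auto_derive.
      apply Rgt_not_eq, sin_gt_0; lra. }
  specialize (Hcov Hside).
  assert (HI : is_RInt_gen (V := C_R_NormedModule)
    (fun theta => RtoC (theta - sigma) * Rcpow (log_sin_ratio z theta) (s - 2))%C
    (at_right 0) (at_left sigma)
    (- (RtoC sigma * (CGamma (s - 1) * DE) - CGamma (s - 1) * DZ))%C).
  { refine (is_RInt_gen_ext (V := C_R_NormedModule) _ _ _ _ Hcov).
    revert Hdom. apply filter_imp. intros [a b]; simpl. intros Hab x Hx.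
    rewrite Rmin_left in Hx by lra. rewrite Rmax_right in Hx by lra.
    assert (G := gen_at_log_sin_ratio sigma x ltac:(lra) ltac:(lra)).
    cbv zeta in G. fold z in G. rewrite <- G, RtoC_mult. unfold h.
    match goal with |- @eq _ ?l ?r => change (@eq C l r) end.
    ring. }
  unfold SLs, CRInt_gen.
  assert (EI := is_RInt_gen_unique (V := C_R_CompleteNormedModule) _ _ HI).
  unfold log_sin_ratio, z in EI. rewrite EI.
  field. now apply CGamma_neq_0.
Qed.

Lemma C_ex_derive_scal (c : C) (f : C -> C) (s : C) :
  @ex_derive C_AbsRing C_NormedModule f s ->
  @ex_derive C_AbsRing C_NormedModule (fun t => c * f t)%C s.
Proof.
  intros [l Hl]. exists (c * l)%C.
  apply (filterdiff_ext_lin (K := C_AbsRing) (U := AbsRing_NormedModule C_AbsRing)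
           (V := C_NormedModule) (fun t => c * f t)%C
           (fun y : C => scal (K := C_AbsRing) (V := C_NormedModule) c
              (scal (K := C_AbsRing) (V := C_NormedModule) y l))).
  - apply (filterdiff_scal_r_fct (K := C_AbsRing) (U := AbsRing_NormedModule C_AbsRing)
             (V := C_NormedModule) c f); [ exact Cmult_comm | exact Hl ].
  - intros y. unfold scal; simpl; unfold mult; simpl. ring.
Qed.

Theorem theorem2p3 :
  forall sigma : R, (0 < sigma < PI)%R ->
    (forall s : C, (1 < Re s)%R ->
       SLs s sigma =
         (zetaCB s (RtoC (sin (sigma / 2)))
          - RtoC (sigma / PI) * etaCB s (RtoC (sin (sigma / 2))))%C) /\
    analytic_continuation
      (fun s : C => (1 < Re s)%R)
      (fun s : C => SLs s sigma)
      (fun _ : C => True)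
      (fun s : C =>
         (zetaCB s (RtoC (sin (sigma / 2)))
          - RtoC (sigma / PI) * etaCB s (RtoC (sin (sigma / 2))))%C).
Proof.
  intros sigma Hsig.
  assert (Hz : 0 < sin (sigma / 2) < 1).
  { split; [ apply sin_gt_0; lra | ].
    rewrite <- sin_PI2. apply sin_increasing_1; lra. }
  assert (HPI := PI_RGT_0).
  (* An identity between series, valid for every s and not only for Re s > 1; it therefore also
     transfers differentiability on all of C. *)
  assert (E : forall s : C,
    (zetaCB s (RtoC (sin (sigma / 2))) - RtoC (sigma / PI) * etaCB s (RtoC (sin (sigma / 2))))%C
    = (dirichlet (zeta_coef (sin (sigma / 2))) zeta_freq s
       - RtoC sigma * dirichlet (eta_coef (sin (sigma / 2))) eta_freq s)%C).
  { intros s. rewrite zetaCB_dirichlet, etaCB_dirichlet by exact Hz.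
    rewrite RtoC_div by lra. field. apply RtoC_neq_0; lra. }
  assert (HS : forall s : C, 1 < Re s ->
    SLs s sigma = (zetaCB s (RtoC (sin (sigma / 2)))
                   - RtoC (sigma / PI) * etaCB s (RtoC (sin (sigma / 2))))%C).
  { intros s Hs. rewrite E. now apply SLs_eq_dirichlet. }
  split; [ exact HS | ]. split; [ auto | split ].
  - intros s _.
    refine (ex_derive_ext (K := C_AbsRing) (V := C_NormedModule) _ _ s (fun t => eq_sym (E t)) _).
    apply (ex_derive_minus (K := C_AbsRing) (V := C_NormedModule)).
    + now apply dirichlet_ex_derive, zeta_summable.
    + apply C_ex_derive_scal. now apply dirichlet_ex_derive, eta_summable.
  - intros s Hs. symmetry. now apply HS.
Qed.
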